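(* If $H$ is a finite dimensional quasi-Hopf algebra, then the two-sided crossed product $H>\!\!\!\triangleleft\; H^*\;\triangleright\!\!\!<H$ is isomorphic to $\mathrm{End}(H)\otimes H$ as associative algebras.
   Context: Throughout, $k$ is a field, all algebras and linear spaces are over $k$, $\otimes=\otimes_k$. A quasi-bialgebra $(H,\Delta,\varepsilon,\Phi)$ is a unital associative algebra $H$ with algebra maps $\Delta:H\to H\otimes H$, $\varepsilon:H\to k$ and an invertible $\Phi\in H^{\otimes 3}$ such that for all $h\in H$: $(id\otimes\Delta)(\Delta(h))=\Phi(\Delta\otimes id)(\Delta(h))\Phi^{-1}$; $(id\otimes\varepsilon)(\Delta(h))=h=(\varepsilon\otimes id)(\Delta(h))$; $(1\otimes\Phi)(id\otimes\Delta\otimes id)(\Phi)(\Phi\otimes 1)=(id\otimes id\otimes\Delta)(\Phi)(\Delta\otimes id\otimes id)(\Phi)$; $(\varepsilon\otimes id\otimes id)(\Phi)=(id\otimes\varepsilon\otimes id)(\Phi)=(id\otimes id\otimes\varepsilon)(\Phi)=1\otimes 1$. Notation (summation understood): $\Delta(h)=h_1\otimes h_2$; $\Phi=X^1\otimes X^2\otimes X^3$, and $\Phi^{-1}=x^1\otimes x^2\otimes x^3=y^1\otimes y^2\otimes y^3$ (independent copies). A quasi-Hopf algebra is a quasi-bialgebra $H$ with an algebra anti-automorphism $S$ and $\alpha,\beta\in H$ such that $S(h_1)\alpha h_2=\varepsilon(h)\alpha$, $h_1\beta S(h_2)=\varepsilon(h)\beta$ for all $h$, $X^1\beta S(X^2)\alpha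 X^3=1$, $S(x^1)\alpha x^2\beta S(x^3)=1$; normalised (as one may) so that $\varepsilon(\alpha)=\varepsilon(\beta)=1$ and $\varepsilon\circ S=\varepsilon$. $H^*$ is the linear dual of $H$, with (in general nonassociative) convolution product $(\varphi\psi)(h)=\varphi(h_1)\psi(h_2)$ and regular actions $(h\rightharpoonup\varphi)(h')=\varphi(h'h)$, $(\varphi\leftharpoonup h)(h')=\varphi(hh')$. For finite dimensional $H$, the two-sided crossed product $H>\!\!\!\triangleleft\; H^*\;\triangleright\!\!\!<H$ is the associative algebra with underlying space $H\otimes H^*\otimes H$ and multiplication $$(h\otimes\varphi\otimes l)(h'\otimes\varphi'\otimes l')=hh'_1x^1\otimes(y^1\rightharpoonup\varphi\leftharpoonup h'_2x^2)(y^2l_1\rightharpoonup\varphi'\leftharpoonup x^3)\otimes y^3l_2l'.$$ $\mathrm{End}(H)$ is the algebra of $k$-linear endomorphisms of $H$, and $\mathrm{End}(H)\otimes H$ is the usual tensor product of algebras. *)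

(* Defs.v *)
From HB Require Import structures.
From mathcomp Require Import all_boot all_algebra sesquilinear falgebra.

Set Implicit Arguments.
Unset Strict Implicit.
Unset Printing Implicit Defensive.

Import GRing.Theory.
Local Open Scope ring_scope.

Reserved Notation "U ⊗ V" (at level 45, right associativity).
Reserved Notation "\tsum_ ( a , b <- t ) E"
  (at level 34, a name, b name, t at level 60, E at level 39,
   format "\tsum_ ( a ,  b  <-  t )  E").
Reserved Notation "\tsum_ ( a , b , c <- t ) E"
  (at level 34, a name, b name, c name, t at level 60, E at level 39,
   format "\tsum_ ( a ,  b ,  c  <-  t )  E").

(* Tensors are coordinate matrices with respect to the library's bases        *)
(* vbasis {:U} and vbasis {:V}.                                               *)
Record tensor (k : fieldType) (U V : vectType k) := Tensor {
  tensor_mx : 'M[k]_(\dim {:U}, \dim {:V})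
}.

Section TensorSpace.
Variables (k : fieldType) (U V : vectType k).

HB.instance Definition _ := [isNew for @tensor_mx k U V].
HB.instance Definition _ := [Choice of tensor U V by <:].

Implicit Types s t : tensor U V.

Definition tensor_add s t : tensor U V := Tensor (tensor_mx s + tensor_mx t).
Definition tensor_opp t : tensor U V := Tensor (- tensor_mx t).
Definition tensor_scale (c : k) t : tensor U V := Tensor (c *: tensor_mx t).

Fact tensor_addA : associative tensor_add.
Proof. by move=> ? ? ?; rewrite /tensor_add /= addrA. Qed.
Fact tensor_addC : commutative tensor_add.
Proof. by move=> ? ?; rewrite /tensor_add addrC. Qed.
Fact tensor_add0 : left_id (Tensor 0) tensor_add.
Proof. by case=> t; rewrite /tensor_add add0r. Qed.
Fact tensor_addN : left_inverse (Tensor 0) tensor_opp tensor_add.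
Proof. by case=> t; rewrite /tensor_add /= addNr. Qed.

HB.instance Definition _ := GRing.isZmodule.Build (tensor U V)
  tensor_addA tensor_addC tensor_add0 tensor_addN.

Fact tensor_scaleA c d t :
  tensor_scale c (tensor_scale d t) = tensor_scale (c * d) t.
Proof. by rewrite /tensor_scale /= scalerA. Qed.
Fact tensor_scale1 : left_id 1 tensor_scale.
Proof. by case=> t; rewrite /tensor_scale /= scale1r. Qed.
Fact tensor_scaleDr : right_distributive tensor_scale +%R.
Proof. by move=> c s t; congr Tensor; rewrite /= scalerDr. Qed.
Fact tensor_scaleDl t : {morph tensor_scale^~ t : a b / a + b}.
Proof. by move=> c d; congr Tensor; rewrite /= scalerDl. Qed.

HB.instance Definition _ := GRing.Zmodule_isLmodule.Build k (tensor U V)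
  tensor_scaleA tensor_scale1 tensor_scaleDr tensor_scaleDl.

Fact tensor_vect_axiom : Vector.axiom (\dim {:U} * \dim {:V}) (tensor U V).
Proof.
exists (fun t => mxvec (tensor_mx t)); first by move=> c s t; rewrite -linearP.
exists (fun x => Tensor (vec_mx x)) => [[t]|x] /=; first by rewrite mxvecK.
by rewrite vec_mxK.
Qed.
HB.instance Definition _ :=
  Lmodule_hasFinDim.Build k (tensor U V) tensor_vect_axiom.

Definition tpure (u : U) (v : V) : tensor U V :=
  Tensor (\matrix_(i, j) (coord (vbasis {:U}) i u * coord (vbasis {:V}) j v)).

(* The linear map on U ⊗ V induced by a bilinear F (see tlift_pure below).    *)
Definition tlift (W : lmodType k) (F : U -> V -> W) (t : tensor U V) : W :=
  \sum_i \sum_j tensor_mx t i j *: F (vbasis {:U})`_i (vbasis {:V})`_j.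

Fact tlift_is_linear (W : lmodType k) (F : U -> V -> W) : linear (@tlift W F).
Proof.
move=> c s t; rewrite scaler_sumr -big_split; apply: eq_bigr => i _ /=.
rewrite scaler_sumr -big_split; apply: eq_bigr => j _ /=.
by rewrite !mxE scalerDl scalerA.
Qed.
HB.instance Definition _ (W : lmodType k) (F : U -> V -> W) :=
  GRing.isLinear.Build k (tensor U V) W _ (@tlift W F) (tlift_is_linear F).

End TensorSpace.

Notation "U ⊗ V" := (tensor U%type V%type) : type_scope.
Notation "u ⊗ v" := (tpure u v) : ring_scope.
(* Sweedler notation: t = a ⊗ b, respectively t = a ⊗ b ⊗ c, summation        *)
(* understood; E has to be multilinear in the bound variables.                *)
Notation "\tsum_ ( a , b <- t ) E" := (tlift (fun a b => E) t) : ring_scope.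
Notation "\tsum_ ( a , b , c <- t ) E" :=
  (tlift (fun a => tlift (fun b c => E)) t) : ring_scope.

Notation bilin F := (bilinear_for *:%R *:%R F).

Section TensorTheory.
Variables (k : fieldType) (U V : vectType k).
Implicit Types (u : U) (v : V) (s t : U ⊗ V).

Lemma tpure_bilin : bilin (@tpure k U V).
Proof.
split=> [v c u1 u2|u c v1 v2]; congr Tensor; apply/matrixP=> i j;
  by rewrite !mxE linearP /= ?mulrDl ?mulrDr -?mulrA // mulrCA.
Qed.
HB.instance Definition _ := bilinear_isBilinear.Build k _ _ _ _ _
  (@tpure k U V) tpure_bilin.

Lemma tensor_decomp t : t =
  \sum_i \sum_j tensor_mx t i j *: ((vbasis {:U})`_i ⊗ (vbasis {:V})`_j).
Proof.
have mxD : {morph @tensor_mx k U V : x y / x + y} by [].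
have mx0 : tensor_mx (0 : U ⊗ V) = 0 by [].
apply: val_inj => /=; rewrite {1}[tensor_mx t]matrix_sum_delta.
rewrite (big_morph _ mxD mx0); apply: eq_bigr => i _.
rewrite (big_morph _ mxD mx0); apply: eq_bigr => j _.
congr (_ *: _); apply/matrixP=> i' j'.
rewrite !mxE !coord_free ?(basis_free (vbasisP _)) //.
by rewrite -natrM mulnb ![_ == i']eq_sym ![_ == j']eq_sym.
Qed.

Lemma tensor_ind (P : U ⊗ V -> Prop) : P 0 ->
  (forall u v, P (u ⊗ v)) -> (forall s t, P s -> P t -> P (s + t)) ->
  forall t, P t.
Proof.
move=> P0 Pp PD t; rewrite (tensor_decomp t); apply: big_ind => // i _.
by apply: big_ind => // j _; rewrite -linearZr_LR; apply: Pp.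
Qed.

Lemma tlift_pure (W : lmodType k) (F : U -> V -> W) u v :
  bilin F -> tlift F (u ⊗ v) = F u v.
Proof.
move=> linF; pose M := bilinear_isBilinear.Build k _ _ _ _ _ F linF.
pose B : {bilinear U -> V -> W} := HB.pack F M.
rewrite -[RHS]/(B u v) [in RHS](coord_vbasis (memvf u)) linear_sumlz.
apply: eq_bigr => i _; rewrite [in RHS](coord_vbasis (memvf v)) linear_sumr.
by apply: eq_bigr => j _; rewrite linearZl_LR linearZr_LR mxE scalerA.
Qed.

Lemma tlift_linearF (W : lmodType k) c (F G H : U -> V -> W) t :
  (forall u v, F u v = c *: G u v + H u v) ->
  tlift F t = c *: tlift G t + tlift H t.
Proof.
move=> defF; rewrite /tlift scaler_sumr -big_split; apply: eq_bigr => i _.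
rewrite /= scaler_sumr -big_split; apply: eq_bigr => j _ /=.
by rewrite defF scalerDr !scalerA mulrC.
Qed.

End TensorTheory.

Section TensorAlgebra.
Variables (k : fieldType) (A B : falgType k).
Implicit Types s t : A ⊗ B.

Definition tensor_mul s t : A ⊗ B :=
  \tsum_(a, b <- s) \tsum_(a', b' <- t) ((a * a') ⊗ (b * b')).

Fact tensor_mul_bilin : bilin tensor_mul.
Proof.
split=> [t|s]; first exact: linearP.
by move=> c t t'; apply: tlift_linearF => a b; apply: linearP.
Qed.
HB.instance Definition _ := bilinear_isBilinear.Build k _ _ _ _ _
  tensor_mul tensor_mul_bilin.

Fact tensor_mul_pure a b a' b' :
  tensor_mul (a ⊗ b) (a' ⊗ b') = (a * a') ⊗ (b * b').
Proof.
rewrite /tensor_mul !tlift_pure //; split=> [y c x x'|x c y y'].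
- by rewrite mulrDr -scalerAr linearPl.
- by rewrite mulrDr -scalerAr linearPr.
- by apply: tlift_linearF => u v; rewrite mulrDl -scalerAl linearPl.
- by apply: tlift_linearF => u v; rewrite mulrDl -scalerAl linearPr.
Qed.

Fact tensor_mulA : associative tensor_mul.
Proof.
move=> r s t.
elim/tensor_ind: r => [|a b|r r' IHr IHr']; rewrite ?(linear0l, linearDl) /= ?IHr ?IHr' //.
elim/tensor_ind: s => [|a' b'|s s' IHs IHs'];
  rewrite ?(linear0l, linear0r, linearDl, linearDr) /= ?IHs ?IHs' //.
elim/tensor_ind: t => [|a'' b''|t t' IHt IHt'];
  rewrite ?(linear0l, linear0r, linearDl, linearDr) /= ?IHt ?IHt' //.
by rewrite !tensor_mul_pure !mulrA.
Qed.

Fact tensor_mul1 : left_id (1 ⊗ 1) tensor_mul.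
Proof.
elim/tensor_ind=> [|a b|s s' IHs IHs']; rewrite ?(linear0r, linearDr) /= ?IHs ?IHs' //.
by rewrite tensor_mul_pure !mul1r.
Qed.

Fact tensor_mulr1 : right_id (1 ⊗ 1) tensor_mul.
Proof.
elim/tensor_ind=> [|a b|s s' IHs IHs']; rewrite ?(linear0l, linearDl) /= ?IHs ?IHs' //.
by rewrite tensor_mul_pure !mulr1.
Qed.

Fact tensor_mulDl : left_distributive tensor_mul +%R.
Proof. by move=> r s t; apply: linearDl. Qed.

Fact tensor_mulDr : right_distributive tensor_mul +%R.
Proof. by move=> r s t; apply: linearDr. Qed.

Fact tensor_one_neq0 : 1 ⊗ 1 != 0 :> A ⊗ B.
Proof.
have [i ai] : exists i, coord (vbasis {:A}) i 1 != 0.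
  apply/existsP; apply: contraNT (oner_neq0 A); rewrite negb_exists.
  move/forallP=> c0; rewrite (coord_vbasis (memvf 1)) big1 // => i _.
  by have /negPn/eqP-> := c0 i; rewrite scale0r.
have [j bj] : exists j, coord (vbasis {:B}) j 1 != 0.
  apply/existsP; apply: contraNT (oner_neq0 B); rewrite negb_exists.
  move/forallP=> c0; rewrite (coord_vbasis (memvf 1)) big1 // => j _.
  by have /negPn/eqP-> := c0 j; rewrite scale0r.
apply/eqP=> /(congr1 (fun t => tensor_mx t i j))/eqP.
by rewrite !mxE mulf_eq0 (negPf ai) (negPf bj).
Qed.

HB.instance Definition _ := GRing.Zmodule_isNzRing.Build (A ⊗ B)%type
  tensor_mulA tensor_mul1 tensor_mulr1 tensor_mulDl tensor_mulDr
  tensor_one_neq0.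

Fact tensor_scaleAl (c : k) s t : c *: (s * t) = (c *: s) * t.
Proof. exact/esym/linearZl_LR. Qed.
HB.instance Definition _ :=
  GRing.Lmodule_isLalgebra.Build k (A ⊗ B)%type tensor_scaleAl.

Fact tensor_scaleAr (c : k) s t : c *: (s * t) = s * (c *: t).
Proof. exact/esym/linearZr_LR. Qed.
HB.instance Definition _ :=
  GRing.Lalgebra_isAlgebra.Build k (A ⊗ B)%type tensor_scaleAr.

HB.instance Definition _ := Algebra_isFalgebra.Build k (A ⊗ B)%type.

Lemma tensor_mulE (a a' : A) (b b' : B) :
  (a ⊗ b) * (a' ⊗ b') = (a * a') ⊗ (b * b').
Proof. exact: tensor_mul_pure. Qed.

Lemma tensor_oneE : 1 = 1 ⊗ 1 :> A ⊗ B.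
Proof. by []. Qed.

End TensorAlgebra.

Section TensorMaps.
Variables (k : fieldType) (U V W U' V' : vectType k).

Definition tmap (f : U -> U') (g : V -> V') (t : U ⊗ V) : U' ⊗ V' :=
  \tsum_(u, v <- t) (f u ⊗ g v).

Definition tassoc (t : (U ⊗ V) ⊗ W) : U ⊗ V ⊗ W :=
  \tsum_(s, w <- t) \tsum_(u, v <- s) (u ⊗ v ⊗ w).

End TensorMaps.
Arguments tassoc {k U V W} t.

(* 'End(V) with composition as product: (f * g) v = f (g v). The library's    *)
(* own (non canonical) ring structure on 'End(V) is the opposite one.         *)
Definition endo (k : fieldType) (V : falgType k) : Type := 'End(V).

Section EndoAlgebra.
Variables (k : fieldType) (V : falgType k).
Implicit Types f g h : endo V.

HB.instance Definition _ := Vector.copy (endo V) 'End(V).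

Definition endo_mul f g : endo V := (f \o g)%VF.

Fact endo_mulA : associative endo_mul.
Proof. by move=> f g h; apply: comp_lfunA. Qed.
Fact endo_mul1 : left_id (\1%VF : endo V) endo_mul.
Proof. by move=> f; apply: comp_lfun1l. Qed.
Fact endo_mulr1 : right_id (\1%VF : endo V) endo_mul.
Proof. by move=> f; apply: comp_lfun1r. Qed.
Fact endo_mulDl : left_distributive endo_mul +%R.
Proof. by move=> f g h; apply: comp_lfunDl. Qed.
Fact endo_mulDr : right_distributive endo_mul +%R.
Proof. by move=> f g h; apply: comp_lfunDr. Qed.
Fact endo_one_neq0 : (\1%VF : endo V) != 0.
Proof.
apply/eqP=> /lfunP/(_ (1 : V)); rewrite id_lfunE zero_lfunE.
exact/eqP/oner_neq0.
Qed.

HB.instance Definition _ := GRing.Zmodule_isNzRing.Build (endo V)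
  endo_mulA endo_mul1 endo_mulr1 endo_mulDl endo_mulDr endo_one_neq0.

Fact endo_scaleAl (c : k) f g : c *: (f * g) = (c *: f) * g.
Proof. exact: comp_lfunZl. Qed.
HB.instance Definition _ :=
  GRing.Lmodule_isLalgebra.Build k (endo V) endo_scaleAl.

Fact endo_scaleAr (c : k) f g : c *: (f * g) = f * (c *: g).
Proof. exact: comp_lfunZr. Qed.
HB.instance Definition _ :=
  GRing.Lalgebra_isAlgebra.Build k (endo V) endo_scaleAr.

HB.instance Definition _ := Algebra_isFalgebra.Build k (endo V).

End EndoAlgebra.

(* Iterated tensor products are nested to the right, so the factors Δ ⊗ id,    *)
(* id ⊗ Δ ⊗ id, Δ ⊗ id ⊗ id and Φ ⊗ 1 of the axioms are re-bracketed by       *)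
(* tassoc. Finite dimension and a chosen unit predicate come with falgType.   *)
HB.mixin Record isQuasiBialgebra (k : fieldType) H of Falgebra k H := {
  coproduct : {lrmorphism H -> H ⊗ H};
  counit : {lrmorphism H -> k^o};
  associator : H ⊗ H ⊗ H;
  associator_unit : associator \is a GRing.unit;
  coproduct_quasi_coassoc : forall h : H,
    tmap id coproduct (coproduct h)
      = associator * tassoc (tmap coproduct id (coproduct h)) * associator^-1;
  coproduct_counitr : forall h : H,
    \tsum_(h1, h2 <- coproduct h) ((counit h2 : k) *: h1) = h;
  coproduct_counitl : forall h : H,
    \tsum_(h1, h2 <- coproduct h) ((counit h1 : k) *: h2) = h;
  associator_pentagon :
    (1 ⊗ associator) * tmap id (tassoc \o tmap coproduct id) associator
        * tmap id tassoc (tassoc (associator ⊗ (1 : H)))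
      = tmap id (tmap id coproduct) associator
        * tassoc (tmap coproduct id associator);
  associator_counit1 :
    \tsum_(X1, X2, X3 <- associator) ((counit X1 : k) *: (X2 ⊗ X3)) = 1 ⊗ 1;
  associator_counit2 :
    \tsum_(X1, X2, X3 <- associator) ((counit X2 : k) *: (X1 ⊗ X3)) = 1 ⊗ 1;
  associator_counit3 :
    \tsum_(X1, X2, X3 <- associator) ((counit X3 : k) *: (X1 ⊗ X2)) = 1 ⊗ 1
}.

#[short(type="quasiBialgType")]
HB.structure Definition QuasiBialgebra (k : fieldType) :=
  { H of Falgebra k H & isQuasiBialgebra k H }.

HB.mixin Record isQuasiHopf (k : fieldType) H of QuasiBialgebra k H := {
  antipode : {linear H -> H};
  antipode_alpha : H;
  antipode_beta : H;
  antipode_bij : bijective antipode;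
  antipode1 : antipode 1 = 1;
  antipodeM : forall g h : H, antipode (g * h) = antipode h * antipode g;
  antipode_alphaP : forall h : H,
    \tsum_(h1, h2 <- coproduct h) (antipode h1 * antipode_alpha * h2)
      = (counit h : k) *: antipode_alpha;
  antipode_betaP : forall h : H,
    \tsum_(h1, h2 <- coproduct h) (h1 * antipode_beta * antipode h2)
      = (counit h : k) *: antipode_beta;
  antipode_associator :
    \tsum_(X1, X2, X3 <- associator)
      (X1 * antipode_beta * antipode X2 * antipode_alpha * X3) = 1;
  antipode_associatorV :
    \tsum_(x1, x2, x3 <- associator^-1)
      (antipode x1 * antipode_alpha * x2 * antipode_beta * antipode x3) = 1;
  counit_alpha : counit antipode_alpha = 1;
  counit_beta : counit antipode_beta = 1;
  counit_antipode : forall h : H, counit (antipode h) = counit h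
}.

#[short(type="quasiHopfType")]
HB.structure Definition QuasiHopf (k : fieldType) :=
  { H of QuasiBialgebra k H & isQuasiHopf k H }.

Section TwoSidedCrossedProduct.
Variables (k : fieldType) (H : quasiHopfType k).
Local Notation "H ^*" := 'Hom(H, k^o) : type_scope.
Implicit Types (f g : H^*) (h l : H).

Local Notation Delta := (@coproduct k H).
Local Notation Phi := (@associator k H).

Definition convolution f g : H^* :=
  linfun (tlift (fun h1 h2 => (f h1 * g h2 : k^o)) \o Delta).

Definition lhit h f : H^* := (f \o amulr h)%VF.
Definition rhit f h : H^* := (f \o amull h)%VF.
Local Notation "h ⇀ f" := (lhit h f) (at level 42, right associativity).
Local Notation "f ↼ h" := (rhit f h) (at level 43, left associativity).

Definition two_sided_crossed : Type := H ⊗ H^* ⊗ H.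
HB.instance Definition _ := Vector.on two_sided_crossed.

Definition crossed_mul_pure h f l h' f' l' : two_sided_crossed :=
  \tsum_(h'1, h'2 <- Delta h') \tsum_(l1, l2 <- Delta l)
  \tsum_(x1, x2, x3 <- Phi^-1) \tsum_(y1, y2, y3 <- Phi^-1)
    ((h * h'1 * x1) ⊗
     convolution (y1 ⇀ f ↼ (h'2 * x2)) ((y2 * l1) ⇀ f' ↼ x3) ⊗
     (y3 * l2 * l')).

(* On pure tensors this is crossed_mul_pure: see crossed_mulE.                *)
Definition crossed_mul (s t : two_sided_crossed) : two_sided_crossed :=
  \tsum_(h, f, l <- s) \tsum_(h', f', l' <- t) crossed_mul_pure h f l h' f' l'.

Definition crossed_one : two_sided_crossed :=
  1 ⊗ (linfun (@counit k H) : H^*) ⊗ 1.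

Lemma convolutionE f g h :
  convolution f g h = \tsum_(h1, h2 <- Delta h) (f h1 * g h2 : k^o).
Proof. by rewrite lfunE. Qed.

Lemma lhitE h f x : (h ⇀ f) x = f (x * h).
Proof. by rewrite comp_lfunE lfunE. Qed.

Lemma rhitE h f x : (f ↼ h) x = f (h * x).
Proof. by rewrite comp_lfunE lfunE. Qed.

Lemma convolution_bilin : bilin convolution.
Proof.
split=> [g|f] c f1 f2; apply/lfunP=> h;
  rewrite !(add_lfunE, scale_lfunE, convolutionE);
  apply: tlift_linearF => a b; rewrite !(add_lfunE, scale_lfunE).
  by rewrite mulrDl -scalerAl.
by rewrite mulrDr -scalerAr.
Qed.
HB.instance Definition _ := bilinear_isBilinear.Build k _ _ _ _ _
  convolution convolution_bilin.

Lemma lhit_bilin : bilin lhit.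
Proof.
split=> [f|h] c x y; apply/lfunP=> a;
  rewrite !(add_lfunE, scale_lfunE, lhitE) //.
by rewrite mulrDr -scalerAr linearP.
Qed.
HB.instance Definition _ := bilinear_isBilinear.Build k _ _ _ _ _
  lhit lhit_bilin.

Lemma rhit_bilin : bilin rhit.
Proof.
split=> [h|f] c x y; apply/lfunP=> a;
  rewrite !(add_lfunE, scale_lfunE, rhitE) //.
by rewrite mulrDl -scalerAl linearP.
Qed.
HB.instance Definition _ := bilinear_isBilinear.Build k _ _ _ _ _
  rhit rhit_bilin.

Lemma crossed_mul_bilin : bilin crossed_mul.
Proof.
split=> [t|s]; first exact: linearP.
move=> c t t'; apply: tlift_linearF => h u; apply: tlift_linearF => f l.
exact: linearP.
Qed.
HB.instance Definition _ := bilinear_isBilinear.Build k _ _ _ _ _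
  crossed_mul crossed_mul_bilin.

Lemma crossed_mulE h f l h' f' l' :
  crossed_mul (h ⊗ f ⊗ l) (h' ⊗ f' ⊗ l') = crossed_mul_pure h f l h' f' l'.
Proof.
have linh f1 l1 h2 f2 l2 : linear (fun x => crossed_mul_pure x f1 l1 h2 f2 l2).
  move=> c x y; do ![apply: tlift_linearF => ? ?].
  by rewrite !mulrDl -!scalerAl linearPl.
have linf h1 l1 h2 f2 l2 : linear (fun x => crossed_mul_pure h1 x l1 h2 f2 l2).
  move=> c x y; do ![apply: tlift_linearF => ? ?].
  by rewrite linearPr linearPl linearPl linearPl linearPr.
have linl h1 f1 h2 f2 l2 : linear (fun x => crossed_mul_pure h1 f1 x h2 f2 l2).
  by move=> c x y; apply: tlift_linearF => ? ?; rewrite !linearP.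
have linh' h1 f1 l1 f2 l2 : linear (fun x => crossed_mul_pure h1 f1 l1 x f2 l2).
  by move=> c x y; rewrite /crossed_mul_pure !linearP.
have linf' h1 f1 l1 h2 l2 : linear (fun x => crossed_mul_pure h1 f1 l1 h2 x l2).
  move=> c x y; do ![apply: tlift_linearF => ? ?].
  by rewrite linearPr linearPl linearPr linearPl linearPr.
have linl' h1 f1 l1 h2 f2 : linear (fun x => crossed_mul_pure h1 f1 l1 h2 f2 x).
  move=> c x y; do ![apply: tlift_linearF => ? ?].
  by rewrite mulrDr -scalerAr !linearPr.
rewrite /crossed_mul !tlift_pure //; split.
- by move=> u c x y; apply: tlift_linearF => ? ?; apply: linh'.
- by move=> u; apply: linearP.
- by move=> u c x y; do 2![apply: tlift_linearF => ? ?]; apply: linf.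
- by move=> u c x y; do 2![apply: tlift_linearF => ? ?]; apply: linl.
- by move=> u c x y; do 3![apply: tlift_linearF => ? ?]; apply: linh.
- by move=> u; apply: linearP.
Qed.

End TwoSidedCrossedProduct.

(* Main.v *)
From HB Require Import structures.
Require Import Defs.
From mathcomp Require Import all_boot all_algebra sesquilinear falgebra.

Set Implicit Arguments.
Unset Strict Implicit.
Unset Printing Implicit Defensive.

Import GRing.Theory.
Local Open Scope ring_scope.

(* Let C be the two-sided crossed product. It acts on Hom(H, H) by            *)
(*   ((h ⊗ φ ⊗ l) u)(g) = φ(v_2 x^2 g_1) h v_1 x^1   with v = u(x^3 g_2 l),    *)
(* and this commutes with the right H-action (u a)(g) = u(a_2 g) a_1. (As     *)
(* H ⊗ H^* = Hom(H, H), this is C tensored with the trivial module over the   *)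
(* right-hand copy of H in C.) Put q = X^1 ⊗ S^-1(α X^3) X^2 and              *)
(* p = x^1 ⊗ x^2 β S(x^3). The identity                                       *)
(*   q^1 (a_1 p^1)_1 ⊗ S^-1(a_2 p^2) q^2 (a_1 p^1)_2 = a ⊗ 1                  *)
(* shows that φ ⊗ a |-> (g |-> φ(q^2 a_2 g) q^1 a_1) maps H^* ⊗ H onto        *)
(* Hom(H, H), hence is an isomorphism of right H-modules. So the action is an *)
(* algebra morphism from C to End_H(H^* ⊗ H) = End(H^* ) ⊗ H, which is        *)
(* End(H) ⊗ H after a choice of basis of H. It is injective, since the        *)
(* pentagon and the same identity recover Σ φ(a) h ⊗ l from the action of     *)
(* Σ h ⊗ φ ⊗ l, and both sides have dimension (dim H)^3.                      *)

(** * Multilinear calculus on tensors *)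

(** The whole argument rests on one faithful module. The crossed product acts on Hom(H, H) by [act].
    Multiplicativity ([act_cross]) and commutation with the right H-action [ract] ([act_ract]) are
    the pentagon and quasi-coassociativity read through that formula. As a right H-module Hom(H, H)
    is free: [Theta] identifies it with H ⊗ H, on which H multiplies the second factor. The
    endomorphisms commuting with that multiplication are exactly End(H) ⊗ H ([endo_act_commutant]),
    so the action becomes an algebra map into End(H) ⊗ H. Injectivity ([act_inj]) and equality of
    dimensions make it bijective; associativity of the crossed product is then inherited from the
    target.

    The identity [qp_cancel] between p and q is used twice. It gives explicit preimages of rank-one
    operators under [Theta], hence surjectivity of [Theta], and it inverts the last stage of the
    recovery of an element of the crossed product from its action. *)

(* Unlike [linear], [lin] is not a product, so that the lemmas below can be   *)
(* applied to it by syntax-directed search.                                   *)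
Definition lin (k : fieldType) (U V : lmodType k) (f : U -> V) : Prop :=
  linear f.

Section Lin.
Variable k : fieldType.
Implicit Types (U V : vectType k) (L M N : lmodType k) (A : falgType k).

Lemma lin_id L : lin (fun x : L => x).
Proof. by []. Qed.

Lemma lin0 L M (f : L -> M) : lin f -> f 0 = 0.
Proof. by move=> /(_ (-1) 0 0); rewrite !scaleN1r !addNr. Qed.

Lemma lin_app L M N (f : {linear M -> N}) (g : L -> M) :
  lin g -> lin (fun x => f (g x)).
Proof. by move=> lg c x y; rewrite lg linearP. Qed.

Lemma lin_lfun_app L U V (f : L -> 'Hom(U, V)) u :
  lin f -> lin (fun x => f x u).
Proof. by move=> lf c x y; rewrite lf add_lfunE scale_lfunE. Qed.

Lemma lin_scalel L M (c : L -> k^o) (m : M) :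
  lin c -> lin (fun x => (c x : k) *: m).
Proof. by move=> lc d x y; rewrite lc scalerDl scalerA. Qed.

Lemma lin_scaler L M (c : k) (g : L -> M) :
  lin g -> lin (fun x => c *: g x).
Proof. by move=> lg d x y; rewrite lg scalerDr !scalerA mulrC. Qed.

Lemma lin_mull L A (f : L -> A) a : lin f -> lin (fun x => f x * a).
Proof. by move=> lf c x y; rewrite lf mulrDl scalerAl. Qed.

Lemma lin_mulr L A (f : L -> A) a : lin f -> lin (fun x => a * f x).
Proof. by move=> lf c x y; rewrite lf mulrDr scalerAr. Qed.

Lemma lin_purel L U V (f : L -> U) (v : V) : lin f -> lin (fun x => f x ⊗ v).
Proof. by move=> lf c x y; rewrite lf linearPl. Qed.

Lemma lin_purer L U V (f : L -> V) (u : U) : lin f -> lin (fun x => u ⊗ f x).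
Proof. by move=> lf c x y; rewrite lf linearPr. Qed.

Lemma lin_tliftF L U V M (F : L -> U -> V -> M) t :
  (forall u v, lin (fun x => F x u v)) -> lin (fun x => tlift (F x) t).
Proof. by move=> lF c x y; apply: tlift_linearF => u v; apply: lF. Qed.

Lemma lin_tlift L U V M (F : U -> V -> M) (f : L -> U ⊗ V) :
  lin f -> lin (fun x => tlift F (f x)).
Proof. exact: lin_app. Qed.

Lemma bilinP U V M (F : U -> V -> M) :
  (forall v, lin (fun u => F u v)) -> (forall u, lin (fun v => F u v)) ->
  bilin F.
Proof. by move=> l r; split=> [v|u]; [apply: l | apply: r]. Qed.

Lemma tensor_ext U V M (f g : U ⊗ V -> M) :
  lin f -> lin g -> (forall u v, f (u ⊗ v) = g (u ⊗ v)) -> forall t, f t = g t.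
Proof.
move=> lf lg fg t; elim/tensor_ind: t => // [|s t fs ft]; first by rewrite !lin0.
by rewrite -[s]scale1r lf lg !scale1r fs ft.
Qed.

(** [linfun] accepts any function; only for a linear one does it return a map with the same values.
    Here linearity is a hypothesis found by search instead of a canonical structure. *)
Lemma lin_lfunE U V (f : U -> V) : lin f -> linfun f =1 f.
Proof.
move=> lf; pose f' : {linear U -> V} := HB.pack f (GRing.isLinear.Build _ _ _ _ f lf).
exact: (lfunE f').
Qed.

Lemma tlift_lin U V L M (f : L -> M) (F : U -> V -> L) t : lin f ->
  tlift (fun a b => f (F a b)) t = f (tlift F t).
Proof.
move=> lf; pose f' : {linear L -> M} := HB.pack f (GRing.isLinear.Build _ _ _ _ f lf).
rewrite -[RHS]/(f' _) /tlift linear_sum; apply: eq_bigr => i _.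
by rewrite linear_sum; apply: eq_bigr => j _; rewrite linearZ.
Qed.

Lemma eq_tlift U V L (F G : U -> V -> L) t :
  (forall a b, F a b = G a b) -> tlift F t = tlift G t.
Proof.
by move=> FG; apply: eq_bigr => i _; apply: eq_bigr => j _; rewrite FG.
Qed.

Lemma tlift_eq0 U V L (F : U -> V -> L) t :
  (forall a b, F a b = 0) -> tlift F t = 0.
Proof.
by move=> F0; apply: big1 => i _; apply: big1 => j _; rewrite F0 scaler0.
Qed.

Lemma lin_sum (I : finType) L M (F : I -> L -> M) :
  (forall i, lin (F i)) -> lin (fun x => \sum_i F i x).
Proof.
move=> lF c x y; rewrite scaler_sumr -big_split; apply: eq_bigr => i _; exact: lF.
Qed.

End Lin.

(** * The dual space: regular actions, convolution, coordinates *)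

Section Dual.
Variables (k : fieldType) (H : falgType k) (Delta : {linear H -> (H ⊗ H)%type}).
Local Notation dual := 'Hom(H, k^o).
Implicit Types (f g : dual) (L : lmodType k).

(* a ⇀ f ↼ b *)
Definition hit f (a b : H) : dual := ((f \o amulr a) \o amull b)%VF.

Definition conv f g : dual :=
  linfun (tlift (fun h1 h2 => (f h1 * g h2 : k^o)) \o Delta).

Lemma hitE f a b h : hit f a b h = f (b * h * a).
Proof. by rewrite !comp_lfunE !lfunE. Qed.

Lemma convE f g h : conv f g h = \tsum_(h1, h2 <- Delta h) (f h1 * g h2 : k^o).
Proof. by rewrite lfunE. Qed.

Lemma lin_hitl L f (a : L -> H) b : lin a -> lin (fun x => hit f (a x) b).
Proof.
move=> la c x y; apply/lfunP=> g.
by rewrite add_lfunE scale_lfunE !hitE la mulrDr -scalerAr linearP.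
Qed.

Lemma lin_hitr L f a (b : L -> H) : lin b -> lin (fun x => hit f a (b x)).
Proof.
move=> lb c x y; apply/lfunP=> g.
by rewrite add_lfunE scale_lfunE !hitE lb !mulrDl -!scalerAl linearP.
Qed.

Lemma lin_convl L (f : L -> dual) g : lin f -> lin (fun x => conv (f x) g).
Proof.
move=> lf c x y; apply/lfunP=> h; rewrite add_lfunE scale_lfunE !convE.
apply: tlift_linearF => a b; rewrite lf add_lfunE scale_lfunE.
by rewrite mulrDl -scalerAl.
Qed.

Lemma lin_convr L f (g : L -> dual) : lin g -> lin (fun x => conv f (g x)).
Proof.
move=> lg c x y; apply/lfunP=> h; rewrite add_lfunE scale_lfunE !convE.
apply: tlift_linearF => a b; rewrite lg add_lfunE scale_lfunE.
by rewrite mulrDr -scalerAr.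
Qed.

Local Notation e := (vbasis {:H}).

(* H and H^* are identified through a basis; no structure is preserved.       *)
Definition dual_vec f : H := \sum_(i < \dim {:H}) (f e`_i : k) *: e`_i.

Definition vec_dual (x : H) : dual :=
  \sum_i coord e i x *: linfun (coord e i : H -> k^o).

Fact dual_vec_is_linear : lin dual_vec.
Proof.
move=> c f g; rewrite /dual_vec scaler_sumr -big_split; apply: eq_bigr => i _.
by rewrite add_lfunE scale_lfunE scalerDl scalerA.
Qed.
HB.instance Definition _ :=
  GRing.isLinear.Build k dual H _ dual_vec dual_vec_is_linear.

Fact vec_dual_is_linear : lin vec_dual.
Proof.
move=> c x y; rewrite /vec_dual scaler_sumr -big_split; apply: eq_bigr => i _.
by rewrite linearP scalerDl scalerA.
Qed.
HB.instance Definition _ :=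
  GRing.isLinear.Build k H dual _ vec_dual vec_dual_is_linear.

Lemma dual_vecK : cancel dual_vec vec_dual.
Proof.
move=> f; apply/lfunP=> h; rewrite [in RHS](coord_vbasis (memvf h)) [RHS]linear_sum.
rewrite sum_lfunE; apply: eq_bigr => i _; rewrite scale_lfunE lfunE linearZ.
rewrite /dual_vec linear_sum (bigD1 i) //= big1 => [|j /negPf ji].
  rewrite linearZ /= coord_free ?(basis_free (vbasisP _)) // eqxx addr0.
  by rewrite mulr1 [RHS]mulrC.
by rewrite linearZ /= coord_free ?(basis_free (vbasisP _)) // ji mulr0.
Qed.

End Dual.

(* A metavariable of an Ltac pattern may capture bound variables, hence the   *)
(* explicit occurrence test.                                                  *)
Ltac depends f :=
  lazymatch f with
  | fun x : ?X => _ => constr:(fun bound : X => ltac:(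
      let b := eval cbv beta in (f bound) in
      lazymatch b with context [bound] => exact true | _ => exact false end))
  | _ => constr:(fun _ : unit => true)
  end.

Ltac if_depends f tac1 tac2 :=
  let d := depends f in
  lazymatch d with (fun _ => true) => tac1 () | _ => tac2 () end.

(** Linearity in one variable by recursion on the expression; at each binary operation the variable
    is followed into the argument where it occurs. *)
Ltac lin :=
  intros; cbv beta;
  lazymatch goal with
  | |- lin (fun x => x) => exact: lin_id
  | |- lin (fun x => tlift (@?F x) _) =>
      if_depends F ltac:(fun _ => apply: lin_tliftF) ltac:(fun _ => apply: lin_tlift); lin
  | |- lin (fun x => tmap _ _ _) => rewrite /tmap; lin
  | |- lin (fun x => tassoc _) => rewrite /tassoc; lin
  | |- lin (fun x => (@?F x) ⊗ _) =>
      if_depends F ltac:(fun _ => apply: lin_purel) ltac:(fun _ => apply: lin_purer); lin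
  | |- lin (fun x => (@?F x) *: _) =>
      if_depends F ltac:(fun _ => apply: lin_scalel) ltac:(fun _ => apply: lin_scaler); lin
  | |- lin (fun x => (@?F x) * _) =>
      if_depends F ltac:(fun _ => apply: lin_mull) ltac:(fun _ => apply: lin_mulr); lin
  | |- lin (fun x => hit _ (@?F x) _) =>
      if_depends F ltac:(fun _ => apply: lin_hitl) ltac:(fun _ => apply: lin_hitr); lin
  | |- lin (fun x => conv _ (@?F x) _) =>
      if_depends F ltac:(fun _ => apply: lin_convl) ltac:(fun _ => apply: lin_convr); lin
  | |- lin (fun x => fun_of_lfun (@?F x) _) =>
      if_depends F ltac:(fun _ => apply: lin_lfun_app) ltac:(fun _ => apply: lin_app); lin
  | |- lin (fun x => _) => apply: lin_app; lin
  | |- lin ?f =>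
      first [exact: linearP | progress (change (lin (fun x => f x))); lin]
  end.

Ltac bil := apply: bilinP; lin.

(** * Coordinate functionals on one factor separate tensors *)

Section Separation.
Variables (k : fieldType) (U V : vectType k).

Lemma tensor_sepl (t : U ⊗ V) :
  (forall i, \tsum_(u, v <- t) (coord (vbasis {:U}) i u *: v) = 0) -> t = 0.
Proof.
move=> t0; suff -> : t = \sum_(i < \dim {:U}) ((vbasis {:U})`_i ⊗
    (\tsum_(u, v <- t) (coord (vbasis {:U}) i u *: v))).
  by apply: big1 => i _; rewrite t0 linear0r.
move: t {t0}; apply: tensor_ext => [||u v]; first by lin.
  by apply: lin_sum => i; lin.
rewrite {1}(coord_vbasis (memvf u)) linear_sumlz; apply: eq_bigr => i _.
by rewrite tlift_pure ?linearZl_LR ?linearZr_LR //; bil.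
Qed.

Lemma tensor_sepr (t : U ⊗ V) :
  (forall i, \tsum_(u, v <- t) (coord (vbasis {:V}) i v *: u) = 0) -> t = 0.
Proof.
move=> t0; suff -> : t = \sum_(i < \dim {:V})
    ((\tsum_(u, v <- t) (coord (vbasis {:V}) i v *: u)) ⊗ (vbasis {:V})`_i).
  by apply: big1 => i _; rewrite t0 linear0l.
move: t {t0}; apply: tensor_ext => [||u v]; first by lin.
  by apply: lin_sum => i; lin.
rewrite {1}(coord_vbasis (memvf v)) linear_sumr; apply: eq_bigr => i _.
by rewrite tlift_pure ?linearZl_LR ?linearZr_LR //; bil.
Qed.

End Separation.

Section TensorMapTheory.
Variables (k : fieldType).
Implicit Types (U V W X Y Z : vectType k) (A B C D : falgType k).

Lemma tmap_pure U V W X (f : U -> W) (g : V -> X) u v :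
  lin f -> lin g -> tmap f g (u ⊗ v) = f u ⊗ g v.
Proof.
move=> lf lg; rewrite /tmap tlift_pure //.
apply: bilinP => [v'|u']; [exact: lin_purel | exact: lin_purer].
Qed.

Lemma tassoc_pure U V W (u : U) (v : V) (w : W) :
  tassoc ((u ⊗ v) ⊗ w) = u ⊗ v ⊗ w.
Proof. by rewrite /tassoc tlift_pure ?tlift_pure //; bil. Qed.

Lemma tassocM A B C (s t : (A ⊗ B) ⊗ C) : tassoc (s * t) = tassoc s * tassoc t.
Proof.
move: s; apply: tensor_ext; [lin | lin | move=> ab c].
move: ab; apply: tensor_ext; [lin | lin | move=> a b].
move: t; apply: tensor_ext; [lin | lin | move=> ab' c'].
move: ab'; apply: tensor_ext; [lin | lin | move=> a' b'].
by rewrite !(tensor_mulE, tassoc_pure).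
Qed.

Lemma tmapM A B C D (f : A -> C) (g : B -> D) : lin f -> lin g ->
  {morph f : x y / x * y} -> {morph g : x y / x * y} ->
  {morph tmap f g : s t / s * t}.
Proof.
move=> lf lg fM gM s t.
move: s; apply: tensor_ext; [lin | lin | move=> a b].
move: t; apply: tensor_ext; [lin | lin | move=> a' b'].
by rewrite !(tensor_mulE, tmap_pure) // fM gM.
Qed.

End TensorMapTheory.

(* An equation linear in t may be proved for t = a ⊗ b, resp. t = a ⊗ b ⊗ c.  *)
Ltac pure2 t a b := move: t; apply: tensor_ext; [by lin | by lin | move=> a b].
Ltac pure3 t a b c :=
  let bc := fresh "bc" in
  pure2 t a bc; pure2 bc b c.
Ltac tpure := repeat (rewrite tlift_pure; last by bil).

(** Pure cancellation of invertible elements, stated in an abstract ring so that the five factors of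
    the pentagon stay opaque. *)
Lemma pentagon_inverses (R : nzRingType) (p1 p2 p3 p4 p5 q1 q2 q3 q4 q5 : R) :
    q1 * p1 = 1 /\ p1 * q1 = 1 -> q2 * p2 = 1 /\ p2 * q2 = 1 ->
    q3 * p3 = 1 /\ p3 * q3 = 1 -> q4 * p4 = 1 /\ p4 * q4 = 1 ->
    q5 * p5 = 1 /\ p5 * q5 = 1 -> p1 * p2 * p3 = p4 * p5 ->
  [/\ q5 * q4 = q3 * q2 * q1, p3 * q5 = q2 * q1 * p4
    & p5 * q3 * q2 = q4 * p1].
Proof.
case=> [qp1 pq1] [qp2 pq2] [qp3 pq3] [qp4 pq4] [qp5 pq5] pent.
have pq45 : p4 * p5 * (q5 * q4) = 1 by rewrite mulrA -(mulrA p4) pq5 mulr1.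
have qp123 : q3 * q2 * q1 * (p1 * p2 * p3) = 1.
  by rewrite !mulrA -(mulrA _ q1) qp1 mulr1 -(mulrA _ q2) qp2 mulr1.
have pentV : q5 * q4 = q3 * q2 * q1.
  by rewrite -[LHS]mul1r -qp123 pent -mulrA pq45 mulr1.
split=> //.
  by rewrite -[q5]mulr1 -qp4 (mulrA q5) pentV !mulrA pq3 mul1r.
rewrite -[LHS]mulr1 -qp1 mulrA -(mulrA _ q2) -(mulrA p5) (mulrA q3) mulrA -!mulrA.
by rewrite (mulrA q2) (mulrA q3) (mulrA q3) -pentV !mulrA pq5 mul1r.
Qed.

(** * Bijectivity by counting dimensions *)

Section Dimension.
Variable k : fieldType.
Implicit Types U V : vectType k.

Lemma dim_tensor U V : \dim {:(U ⊗ V)%type} = (\dim {:U} * \dim {:V})%N.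
Proof. by rewrite [LHS]dimvf. Qed.

Lemma dim_hom U V : \dim {:'Hom(U, V)} = (\dim {:U} * \dim {:V})%N.
Proof. by rewrite !dimvf. Qed.

Lemma inj_dim_bij U V (f : 'Hom(U, V)) :
  injective f -> \dim {:U} = \dim {:V} -> bijective f.
Proof.
move/lker0P=> f0 dimUV; exists (f^-1)%VF; first exact: lker0_lfunK.
move=> v; apply: limg_lfunVK; suff -> : limg f = fullv by apply: memvf.
apply/eqP; rewrite eqEdim subvf -dimUV -(limg_ker_dim f fullv).
by rewrite (eqP f0) capv0 dimv0 add0n leqnn.
Qed.

Lemma surj_dim_inj U V (f : 'Hom(U, V)) :
  (forall v, exists u, f u = v) -> \dim {:U} = \dim {:V} -> injective f.
Proof.
move=> fsurj dimUV; apply/lker0P; rewrite -dimv_eq0 -(eqn_add2r (\dim {:V})).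
rewrite add0n -{2}dimUV -(limg_ker_dim f fullv) capfv.
suff -> : limg f = fullv by [].
apply/vspaceP=> v; rewrite memvf; have [u <-] := fsurj v.
by rewrite memv_img ?memvf.
Qed.

End Dimension.

(** * H-linear endomorphisms of H ⊗ H *)

Section Commutant.
Variables (k : fieldType) (H : falgType k).
Local Notation H2 := (H ⊗ H)%type.
Local Notation E2 := (endo H ⊗ H)%type.

Definition rmul (w : H2) (b : H) : H2 := \tsum_(x, a <- w) (x ⊗ (a * b)).

Definition endo_act (t : E2) : 'End(H2) :=
  linfun (fun w => tlift (fun (p : endo H) b =>
    \tsum_(x, a <- w) ((p : 'End(H)) x ⊗ (b * a))) t).

Lemma endo_actE t w : endo_act t w = tlift (fun (p : endo H) b =>
    \tsum_(x, a <- w) ((p : 'End(H)) x ⊗ (b * a))) t.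
Proof. by rewrite lin_lfunE //; lin. Qed.

Lemma endo_act_is_linear : lin endo_act.
Proof.
by move=> c s t; apply/lfunP=> w; rewrite add_lfunE scale_lfunE !endo_actE linearP.
Qed.
HB.instance Definition _ :=
  GRing.isLinear.Build k E2 'End(H2) _ endo_act endo_act_is_linear.

Lemma endo_act_pure (p : endo H) b x a :
  endo_act (p ⊗ b) (x ⊗ a) = (p : 'End(H)) x ⊗ (b * a).
Proof. by rewrite endo_actE; tpure. Qed.

Lemma endo_act1 : endo_act 1 = \1%VF.
Proof.
apply/lfunP=> w; rewrite id_lfunE; pure2 w x a.
by rewrite endo_act_pure id_lfunE mul1r.
Qed.

Lemma endo_actM s t : endo_act (s * t) = (endo_act s \o endo_act t)%VF.
Proof.
apply/lfunP=> w; rewrite comp_lfunE; pure2 w x a; pure2 s p b; pure2 t q d.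
by rewrite tensor_mulE !endo_act_pure comp_lfunE mulrA.
Qed.

(** The values on x ⊗ 1, read off by coordinates in the second factor, already determine the
    tensor. *)
Lemma endo_act_inj : injective endo_act.
Proof.
suff inj0 t : endo_act t = 0 -> t = 0.
  by move=> s t /eqP; rewrite -subr_eq0 -linearB => /eqP/inj0/subr0_eq.
move=> t0; apply: tensor_sepr => i; apply/lfunP=> x; rewrite zero_lfunE.
transitivity (\tsum_(y, a <- endo_act t (x ⊗ 1)) (coord (vbasis {:H}) i a *: y)).
  move: t {t0}; apply: tensor_ext; [by lin | by lin | move=> p b].
  by rewrite endo_act_pure mulr1; tpure; rewrite scale_lfunE.
by rewrite t0 zero_lfunE linear0.
Qed.

(** Commuting with right multiplication, [g] is determined by g(x ⊗ 1); expanding the second factor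
    of that value in a basis gives the endomorphisms [e i] of the preimage. *)
Lemma endo_act_commutant (g : 'End(H2)) :
  (forall x a b, g (x ⊗ (a * b)) = rmul (g (x ⊗ a)) b) ->
  exists t, endo_act t = g.
Proof.
move=> gr; pose e i : endo H :=
  linfun (fun x => \tsum_(y, a <- g (x ⊗ 1)) (coord (vbasis {:H}) i a *: y)).
exists (\sum_(i < \dim {:H}) (e i ⊗ (vbasis {:H})`_i)); apply/lfunP=> w.
pure2 w x a; rewrite -[a in RHS]mul1r gr linear_sum sum_lfunE /=.
transitivity (\sum_(i < \dim {:H})
   ((\tsum_(y, b <- g (x ⊗ 1)) (coord (vbasis {:H}) i b *: y)) ⊗
   ((vbasis {:H})`_i * a))).
  by apply: eq_bigr => i _; rewrite endo_act_pure lin_lfunE //; lin.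
rewrite /rmul; move: (g _) => s; move: s.
apply: tensor_ext => [||y b]; first by apply: lin_sum => i; lin.
  by lin.
tpure; rewrite [in RHS](coord_vbasis (memvf b)) mulr_suml linear_sumr.
apply: eq_bigr => i _; tpure.
by rewrite -scalerAl linearZl_LR linearZr_LR.
Qed.

End Commutant.

(** * Quasi-Hopf data and the pentagon *)

(* The structure of a quasi-Hopf algebra as unbundled data on an algebra H;   *)
(* PhiV is Φ^-1 and, below, T, A and B are S^-1, S^-1(α) and S^-1(β).         *)
Section QuasiHopfData.
Variables (k : fieldType) (H : falgType k).
Local Notation H2 := (H ⊗ H)%type.
Local Notation H3 := (H ⊗ H ⊗ H)%type.
Local Notation H4 := (H ⊗ H ⊗ H ⊗ H)%type.
Variables (Delta : {linear H -> H2}) (eps : {linear H -> k^o}) (Phi PhiV : H3).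
Hypothesis DeltaM : {morph Delta : g h / g * h}.
Hypothesis Delta1 : Delta 1 = 1.
Hypothesis epsM : forall g h, eps (g * h) = (eps g : k) * eps h.
Hypothesis eps1 : eps 1 = 1.
Hypothesis mulPhiVl : PhiV * Phi = 1.
Hypothesis mulPhiVr : Phi * PhiV = 1.
Hypothesis coassoc : forall h,
  tmap id Delta (Delta h) = Phi * tassoc (tmap Delta id (Delta h)) * PhiV.
Hypothesis Delta_counitr : forall h : H,
  \tsum_(h1, h2 <- Delta h) ((eps h2 : k) *: h1) = h.
Hypothesis Delta_counitl : forall h : H,
  \tsum_(h1, h2 <- Delta h) ((eps h1 : k) *: h2) = h.
Hypothesis Phi_pentagon :
  (1 ⊗ Phi) * tmap id (tassoc \o tmap Delta id) Phi
      * tmap id tassoc (tassoc (Phi ⊗ (1 : H)))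
    = tmap id (tmap id Delta) Phi * tassoc (tmap Delta id Phi).
Hypothesis Phi_counit2 :
  \tsum_(X1, X2, X3 <- Phi) ((eps X2 : k) *: (X1 ⊗ X3)) = 1 ⊗ 1.
Hypothesis Phi_counit3 :
  \tsum_(X1, X2, X3 <- Phi) ((eps X3 : k) *: (X1 ⊗ X2)) = 1 ⊗ 1.

Definition legs234 (t : H3) : H4 := 1 ⊗ t.
Definition legs123 (t : H3) : H4 := tmap id tassoc (tassoc (t ⊗ (1 : H))).
Definition coprod1 (t : H3) : H4 := tassoc (tmap Delta id t).
Definition coprod2 (t : H3) : H4 := tmap id (fun s => tassoc (tmap Delta id s)) t.
Definition coprod3 (t : H3) : H4 := tmap id (tmap id Delta) t.
Definition coprodl (t : H2) : H3 := tassoc (tmap Delta id t).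
Definition coprodr (t : H2) : H3 := tmap id Delta t.

Fact legs234_is_linear : lin legs234.
Proof. by rewrite /legs234; lin. Qed.
HB.instance Definition _ :=
  GRing.isLinear.Build k H3 H4 _ legs234 legs234_is_linear.

Fact legs123_is_linear : lin legs123.
Proof. by rewrite /legs123; lin. Qed.
HB.instance Definition _ :=
  GRing.isLinear.Build k H3 H4 _ legs123 legs123_is_linear.

Fact coprod1_is_linear : lin coprod1.
Proof. by rewrite /coprod1; lin. Qed.
HB.instance Definition _ :=
  GRing.isLinear.Build k H3 H4 _ coprod1 coprod1_is_linear.

Fact coprod2_is_linear : lin coprod2.
Proof. by rewrite /coprod2; lin. Qed.
HB.instance Definition _ :=
  GRing.isLinear.Build k H3 H4 _ coprod2 coprod2_is_linear.

Fact coprod3_is_linear : lin coprod3.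
Proof. by rewrite /coprod3; lin. Qed.
HB.instance Definition _ :=
  GRing.isLinear.Build k H3 H4 _ coprod3 coprod3_is_linear.

Fact coprodl_is_linear : lin coprodl.
Proof. by rewrite /coprodl; lin. Qed.
HB.instance Definition _ :=
  GRing.isLinear.Build k H2 H3 _ coprodl coprodl_is_linear.

Fact coprodr_is_linear : lin coprodr.
Proof. by rewrite /coprodr; lin. Qed.
HB.instance Definition _ :=
  GRing.isLinear.Build k H2 H3 _ coprodr coprodr_is_linear.

Lemma legs234M : {morph legs234 : s t / s * t}.
Proof. by move=> s t; rewrite /legs234 tensor_mulE mulr1. Qed.

Lemma legs123M : {morph legs123 : s t / s * t}.
Proof.
move=> s t; rewrite /legs123 -[in LHS](mulr1 1) -tensor_mulE tassocM tmapM //.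
  by lin.
exact: tassocM.
Qed.

Lemma coprodlM : {morph coprodl : s t / s * t}.
Proof. by move=> s t; rewrite /coprodl tmapM ?tassocM //; lin. Qed.

Lemma coprodrM : {morph coprodr : s t / s * t}.
Proof. by apply: tmapM => //; lin. Qed.

Lemma coprod1M : {morph coprod1 : s t / s * t}.
Proof. by move=> s t; rewrite /coprod1 tmapM ?tassocM //; lin. Qed.

Lemma coprod2M : {morph coprod2 : s t / s * t}.
Proof. by apply: tmapM => //; [lin | exact: coprodlM]. Qed.

Lemma coprod3M : {morph coprod3 : s t / s * t}.
Proof. by apply: tmapM => //; [lin | exact: coprodrM]. Qed.

Lemma legs234_1 : legs234 1 = 1. Proof. by []. Qed.

Lemma legs123_1 : legs123 1 = 1.
Proof.
rewrite /legs123 tassoc_pure tmap_pure //; last by lin.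
by rewrite tassoc_pure.
Qed.

Lemma coprodl_1 : coprodl 1 = 1.
Proof.
rewrite /coprodl tmap_pure //; last by lin.
by rewrite Delta1 tassoc_pure.
Qed.

Lemma coprodr_1 : coprodr 1 = 1.
Proof.
rewrite /coprodr tmap_pure //; last by lin.
by rewrite Delta1.
Qed.

Lemma coprod1_1 : coprod1 1 = 1.
Proof.
rewrite /coprod1 tmap_pure //; last by lin.
by rewrite Delta1 tassoc_pure.
Qed.

Lemma coprod2_1 : coprod2 1 = 1.
Proof.
rewrite /coprod2 tmap_pure //; last by lin.
by rewrite -/(coprodl _) coprodl_1.
Qed.

Lemma coprod3_1 : coprod3 1 = 1.
Proof.
rewrite /coprod3 tmap_pure //; last by lin.
by rewrite -/(coprodr _) coprodr_1.
Qed.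

Lemma morph_PhiV (f : H3 -> H4) : {morph f : s t / s * t} -> f 1 = 1 ->
  f PhiV * f Phi = 1 /\ f Phi * f PhiV = 1.
Proof. by move=> fM f1; rewrite -!fM mulPhiVl mulPhiVr. Qed.

Lemma quasi_coassoc h : coprodr (Delta h) * Phi = Phi * coprodl (Delta h).
Proof. by rewrite /coprodr coassoc -mulrA mulPhiVl mulr1. Qed.

Lemma quasi_coassocV h : PhiV * coprodr (Delta h) = coprodl (Delta h) * PhiV.
Proof.
rewrite -[LHS]mulr1 -mulPhiVr mulrA -(mulrA PhiV) quasi_coassoc.
by rewrite !mulrA mulPhiVl mul1r.
Qed.

Lemma pentagon :
  legs234 Phi * coprod2 Phi * legs123 Phi = coprod3 Phi * coprod1 Phi.
Proof. exact: Phi_pentagon. Qed.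

(** The three rearrangements serve [act_cross], [qp_cancel] and [act_qE], in this order. *)
Lemma pentagonV :
  [/\ coprod1 PhiV * coprod3 PhiV = legs123 PhiV * coprod2 PhiV * legs234 PhiV,
      legs123 Phi * coprod1 PhiV = coprod2 PhiV * legs234 PhiV * coprod3 Phi
    & coprod1 Phi * legs123 PhiV * coprod2 PhiV = coprod3 PhiV * legs234 Phi].
Proof.
apply: pentagon_inverses pentagon.
- exact: morph_PhiV legs234M legs234_1.
- exact: morph_PhiV coprod2M coprod2_1.
- exact: morph_PhiV legs123M legs123_1.
- exact: morph_PhiV coprod3M coprod3_1.
- exact: morph_PhiV coprod1M coprod1_1.
Qed.

Lemma morph_PhiV_eq1 (f : H3 -> H2) : {morph f : s t / s * t} ->
  f (1 ⊗ 1 ⊗ 1) = 1 -> f Phi = 1 -> f PhiV = 1.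
Proof.
by move=> fM f1 fPhi; have := fM PhiV Phi; rewrite mulPhiVl fPhi mulr1 [f 1]f1.
Qed.

Lemma PhiV_counit2 :
  \tsum_(x1, x2, x3 <- PhiV) ((eps x2 : k) *: (x1 ⊗ x3)) = 1 ⊗ 1.
Proof.
pose f (t : H3) := \tsum_(x1, x2, x3 <- t) ((eps x2 : k) *: (x1 ⊗ x3)).
apply: (morph_PhiV_eq1 (f := f) _ _ Phi_counit2) => [s t|]; rewrite /f.
  pure3 s a b c; pure3 t a' b' c'; rewrite !tensor_mulE; tpure.
  by rewrite -scalerAl -scalerAr scalerA tensor_mulE epsM.
by tpure; rewrite eps1 scale1r.
Qed.

Lemma PhiV_counit3 :
  \tsum_(x1, x2, x3 <- PhiV) ((eps x3 : k) *: (x1 ⊗ x2)) = 1 ⊗ 1.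
Proof.
pose f (t : H3) := \tsum_(x1, x2, x3 <- t) ((eps x3 : k) *: (x1 ⊗ x2)).
apply: (morph_PhiV_eq1 (f := f) _ _ Phi_counit3) => [s t|]; rewrite /f.
  pure3 s a b c; pure3 t a' b' c'; rewrite !tensor_mulE; tpure.
  by rewrite -scalerAl -scalerAr scalerA tensor_mulE epsM.
by tpure; rewrite eps1 scale1r.
Qed.

Lemma legs123_pure (a b c : H) : legs123 (a ⊗ b ⊗ c) = a ⊗ b ⊗ c ⊗ 1.
Proof. by rewrite /legs123 tassoc_pure tmap_pure ?tassoc_pure //; lin. Qed.

Lemma legs234_pure (t : H3) : legs234 t = 1 ⊗ t. Proof. by []. Qed.

Lemma coprodl_pure (a b : H) : coprodl (a ⊗ b) = tassoc (Delta a ⊗ b).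
Proof. by rewrite /coprodl tmap_pure //; lin. Qed.

Lemma coprodr_pure (a b : H) : coprodr (a ⊗ b) = a ⊗ Delta b.
Proof. by rewrite /coprodr tmap_pure //; lin. Qed.

Lemma coprod1_pure (a : H) (t : H2) : coprod1 (a ⊗ t) = tassoc (Delta a ⊗ t).
Proof. by rewrite /coprod1 tmap_pure //; lin. Qed.

Lemma coprod2_pure (a : H) (t : H2) : coprod2 (a ⊗ t) = a ⊗ coprodl t.
Proof. by rewrite /coprod2 tmap_pure //; lin. Qed.

Lemma coprod3_pure (a : H) (t : H2) : coprod3 (a ⊗ t) = a ⊗ coprodr t.
Proof. by rewrite /coprod3 tmap_pure //; lin. Qed.

(** * The identity relating p and q *)

Variables (T : {linear H -> H}) (A B : H).
Hypothesis TM : forall g h, T (g * h) = T h * T g.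
Hypothesis T_alphaP : forall h,
  \tsum_(h1, h2 <- Delta h) (T h2 * A * h1) = (eps h : k) *: A.
Hypothesis T_betaP : forall h,
  \tsum_(h1, h2 <- Delta h) (h2 * B * T h1) = (eps h : k) *: B.
Hypothesis T_PhiV : \tsum_(x1, x2, x3 <- PhiV) (x3 * B * T x2 * A * x1) = 1.

(* q^1 (h_1 p^1)_1 ⊗ S^-1(h_2 p^2) q^2 (h_1 p^1)_2 = h ⊗ 1                   *)
Lemma qp_cancel h :
  \tsum_(h1, h2 <- Delta h) \tsum_(x1, x2, x3 <- PhiV) \tsum_(X1, X2, X3 <- Phi)
  \tsum_(c1, c2 <- Delta (h1 * x1))
    ((X1 * c1) ⊗ (x3 * B * T x2 * T h2 * T X3 * A * X2 * c2)) = h ⊗ 1.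
Proof.
(* [N] contracts a 4-tensor so that a coproduct in legs 2, 3 meets [T_alphaP] and one in legs 3, 4
   meets [T_betaP]. *)
pose N (t : H4) : H2 :=
  tlift (fun a => tlift (fun b => tlift (fun c d => a ⊗ (d * B * T c * A * b)))) t.
transitivity (N (legs123 (Phi * coprodl (Delta h)) * coprod1 PhiV)).
  rewrite {}/N; move: (Delta h) => s.
  pure2 s h1 h2; tpure.
  move: Phi PhiV => X x.
  pure3 x x1 x2 x3; pure3 X X1 X2 X3; tpure.
  rewrite DeltaM coprodl_pure coprod1_pure.
  move: (Delta h1) (Delta x1) => u v.
  pure2 u u1 u2; pure2 v v1 v2.
  rewrite !(tassoc_pure, tensor_mulE, legs123_pure); tpure.
  by rewrite !TM !mulrA mul1r.
have [_ pentl _] := pentagonV.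
rewrite -quasi_coassoc legs123M -mulrA pentl.
(* After quasi-coassociativity and the pentagon, legs 2, 3 carry Δ(h_2 x^2) and legs 3, 4 carry
   Δ(Y^3). Both collapse to counits, and only the factor z^3 B T(z^2) A z^1 of [T_PhiV] is left. *)
have NE s x z Y : N (legs123 (coprodr s) * (coprod2 x * legs234 z * coprod3 Y)) =
    \tsum_(x1, x3 <- \tsum_(x1, x2, x3 <- x) ((eps x2 : k) *: (x1 ⊗ x3)))
    \tsum_(z1, z2, z3 <- z)
    \tsum_(Y1, Y2 <- \tsum_(Y1, Y2, Y3 <- Y) ((eps Y3 : k) *: (Y1 ⊗ Y2)))
     (((\tsum_(h1, h2 <- s) ((eps h2 : k) *: h1)) * x1 * Y1)
        ⊗ (x3 * (z3 * B * T z2 * A * z1) * Y2)).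
  rewrite {}/N; pure2 s h1 h2; pure3 x x1 x2 x3; pure3 z z1 z2 z3; pure3 Y Y1 Y2 Y3.
  rewrite coprodr_pure coprod2_pure legs234_pure coprod3_pure coprodl_pure coprodr_pure.
  tpure.
  transitivity ((h1 * x1 * Y1) ⊗ (x3 * z3 *
     (\tsum_(a, b <- Delta Y3) (b * B * T a)) * T z2 *
     (\tsum_(a, b <- Delta (h2 * x2)) (T b * A * a)) * z1 * Y2)).
    rewrite DeltaM; move: (Delta h2) (Delta x2) (Delta Y3) => u v w.
    pure2 u u1 u2; pure2 v v1 v2; pure2 w w1 w2.
    rewrite !(tassoc_pure, tensor_mulE, legs123_pure); tpure.
    by rewrite !TM !mulrA !mul1r mulr1.
  rewrite T_betaP T_alphaP epsM.
  rewrite linearZ /=; tpure; rewrite linearZ /=; tpure.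
  rewrite -!(scalerAl, scalerAr) !(linearZl_LR, linearZr_LR) /= !mulrA !scalerA.
  by congr (_ *: _); rewrite -[LHS]mulrA; apply: mulrC.
rewrite NE PhiV_counit2 Phi_counit3 Delta_counitr.
transitivity (h ⊗ (\tsum_(z1, z2, z3 <- PhiV) (z3 * B * T z2 * A * z1))).
  by move: PhiV => z; pure3 z z1 z2 z3; tpure; rewrite !mulr1 mul1r.
by rewrite T_PhiV.
Qed.

(** * The action of the crossed product on Hom(H, H) *)

Local Notation dual := 'Hom(H, k^o).
Local Notation C := (H ⊗ dual ⊗ H)%type.
Implicit Types (f : dual) (u : 'End(H)).

(* The arguments x and y of [cross], and x of [act0] and [act_rank_one], are  *)
(* instantiated with Φ^-1; they are kept apart so that each can be reduced to *)
(* a pure tensor.                                                             *)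
Definition cross (x y : H3) h (f : dual) l h' (f' : dual) l' : C :=
  \tsum_(h'1, h'2 <- Delta h') \tsum_(l1, l2 <- Delta l)
  \tsum_(x1, x2, x3 <- x) \tsum_(y1, y2, y3 <- y)
    ((h * h'1 * x1) ⊗
     conv Delta (hit f y1 (h'2 * x2)) (hit f' (y2 * l1) x3) ⊗
     (y3 * l2 * l')).

Definition act0 (x : H3) h (f : dual) l (u : 'End(H)) (g : H) : H :=
  \tsum_(g1, g2 <- Delta g) \tsum_(x1, x2, x3 <- x)
  \tsum_(u1, u2 <- Delta (u (x3 * g2 * l)))
    ((f (u2 * x2 * g1) : k) *: (h * u1 * x1)).

Definition act (c : C) (u : 'End(H)) : 'End(H) :=
  linfun (fun g => \tsum_(h, f, l <- c) act0 PhiV h f l u g).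

Lemma actE (c : C) u g : act c u g = \tsum_(h, f, l <- c) act0 PhiV h f l u g.
Proof. by rewrite lin_lfunE //; rewrite /act0; lin. Qed.

Lemma act_pure h f l u g : act (h ⊗ f ⊗ l) u g = act0 PhiV h f l u g.
Proof. by rewrite actE /act0; tpure. Qed.

(** Normal form of two successive actions: all reassociators are gathered in one 4-tensor, ready for
    the pentagon. [G] stands for Δ(g), generalised so that it can be reduced to a pure tensor. *)
Lemma act0_act0 (G : H2) (x y : H3) h (f : dual) l h' (f' : dual) l' u :
  \tsum_(g1, g2 <- G) \tsum_(x1, x2, x3 <- x)
  \tsum_(u1, u2 <- Delta (act0 y h' f' l' u (x3 * g2 * l)))
    ((f (u2 * x2 * g1) : k) *: (h * u1 * x1)) =
  \tsum_(h1, h2 <- Delta h') \tsum_(l1, l2 <- Delta l)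
  tlift (fun a => tlift (fun b => tlift (fun c d =>
    \tsum_(p, q, r <- coprodl (Delta (u (d * l2 * l'))) * (a ⊗ b ⊗ c))
     ((f (h2 * q) * f' (r * l1) : k^o) *: (h * h1 * p : H) : H))))
   (coprod1 y * coprod3 x * legs234 (coprodr G)).
Proof.
have stepL V b c x1 x2 y1 g1 :
    \tsum_(w1, w2 <- Delta (\tsum_(v1, v2 <- V)
                              ((f' (v2 * b * c) : k) *: (h' * v1 * y1))))
       ((f (w2 * x2 * g1) : k) *: (h * w1 * x1)) =
    \tsum_(h1, h2 <- Delta h') \tsum_(z1, z2 <- Delta y1) \tsum_(p, q, r <- coprodl V)
      ((f (h2 * q * z2 * x2 * g1) * f' (r * b * c) : k^o)
         *: (h * (h1 * p * z1) * x1 : H) : H).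
  pure2 V v1 v2; tpure; rewrite linearZ /= linearZ /= !DeltaM coprodl_pure.
  move: (Delta h') (Delta v1) (Delta y1) => H' V1 Y1.
  pure2 H' h1 h2; pure2 V1 v11 v12; pure2 Y1 y11 y12.
  rewrite tassoc_pure !tensor_mulE; tpure.
  by rewrite scalerA mulrC.
rewrite /act0; pure2 G g1 g2; pure3 x x1 x2 x3; pure3 y y1 y2 y3; tpure.
rewrite !DeltaM coprod1_pure coprod3_pure !coprodr_pure legs234_pure.
move: (Delta l) (Delta g2) (Delta x3) => L G2 X3.
pure2 L l1 l2; pure2 G2 g21 g22; pure2 X3 x31 x32.
rewrite !tensor_mulE; tpure; rewrite stepL.
move: (Delta h') (Delta y1) => H' Y1; pure2 H' h1 h2; pure2 Y1 y11 y12.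
rewrite tassoc_pure !tensor_mulE; tpure; rewrite !mulrA.
move: (coprodl _) => W; pure3 W p q r; rewrite !tensor_mulE; tpure.
by rewrite !mulrA !mulr1.
Qed.

(** The action of a product, in the same normal form as [act0_act0]; the two differ only in the
    reassociators. *)
Lemma act0_cross (G : H2) (x y z : H3) h (f : dual) l h' (f' : dual) l' (u : 'End(H)) :
  tlift (fun h0 => tlift (fun (f0 : dual) l0 =>
      \tsum_(g1, g2 <- G) \tsum_(z1, z2, z3 <- z) \tsum_(u1, u2 <- Delta (u (z3 * g2 * l0)))
        ((f0 (u2 * z2 * g1) : k) *: (h0 * u1 * z1))))
    (cross x y h f l h' f' l') =
  \tsum_(h1, h2 <- Delta h') \tsum_(l1, l2 <- Delta l)
  tlift (fun a => tlift (fun b => tlift (fun c d =>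
    \tsum_(p, q, r <- x * coprodr (Delta (u (d * l2 * l'))) * (a ⊗ b ⊗ c))
     ((f (h2 * q) * f' (r * l1) : k^o) *: (h * h1 * p : H) : H))))
   (coprod2 z * legs234 (coprodl G * y)).
Proof.
have stepR V z1 z2 g1 h0 (F1 F2 : dual) :
    \tsum_(v1, v2 <- V) ((conv Delta F1 F2 (v2 * z2 * g1) : k) *: (h0 * v1 * z1)) =
    \tsum_(c1, c2 <- Delta z2) \tsum_(e1, e2 <- Delta g1) \tsum_(p, q, r <- coprodr V)
      ((F1 (q * c1 * e1) * F2 (r * c2 * e2) : k^o) *: (h0 * p * z1 : H) : H).
  pure2 V v1 v2; tpure; rewrite convE !DeltaM coprodr_pure.
  move: (Delta v2) (Delta z2) (Delta g1) => V2 Z2 G1.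
  by pure2 V2 v21 v22; pure2 Z2 z21 z22; pure2 G1 g11 g12; rewrite !tensor_mulE; tpure.
rewrite /cross; pure2 G g1 g2; pure3 x x1 x2 x3; pure3 y y1 y2 y3; pure3 z z1 z2 z3.
move: (Delta h') (Delta l) => H' L; pure2 H' h1 h2; pure2 L l1 l2; tpure.
rewrite coprod2_pure legs234_pure !coprodl_pure stepR.
move: (Delta z2) (Delta g1) => Z2 G1; pure2 Z2 z21 z22; pure2 G1 g11 g12.
rewrite !(tassoc_pure, tensor_mulE); tpure; rewrite !mulrA.
move: (coprodr _) => W; pure3 W p q r; rewrite !tensor_mulE; tpure.
by rewrite !hitE !mulrA !mulr1.
Qed.

Lemma act_cross h f l h' f' l' u :
  act (cross PhiV PhiV h f l h' f' l') u = act (h ⊗ f ⊗ l) (act (h' ⊗ f' ⊗ l') u).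
Proof.
apply/lfunP => g; rewrite act_pure actE act0_cross.
transitivity (\tsum_(g1, g2 <- Delta g) \tsum_(x1, x2, x3 <- PhiV)
    \tsum_(u1, u2 <- Delta (act0 PhiV h' f' l' u (x3 * g2 * l)))
      ((f (u2 * x2 * g1) : k) *: (h * u1 * x1))); last first.
  apply: eq_tlift => g1 g2; apply: eq_tlift => x1 x23.
  by apply: eq_tlift => x2 x3; rewrite act_pure.
rewrite act0_act0; apply: eq_tlift => h1 h2; apply: eq_tlift => l1 l2.
transitivity (tlift (fun a => tlift (fun b => tlift (fun c d =>
    \tsum_(p, q, r <- coprodl (Delta (u (d * l2 * l'))) * PhiV * (a ⊗ b ⊗ c))
     ((f (h2 * q) * f' (r * l1) : k^o) *: (h * h1 * p : H) : H))))
   (coprod2 PhiV * legs234 (coprodl (Delta g) * PhiV))).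
  apply: eq_tlift => a bcd; apply: eq_tlift => b cd; apply: eq_tlift => c d.
  by rewrite quasi_coassocV.
(* The pentagon leaves Φ^-1 on legs 1, 2, 3, where it supplies the one beside [coprodl]; the Φ^-1 on
   legs 2, 3, 4 is moved past the coproducts of g. *)
have [pentVV _ _] := pentagonV.
rewrite pentVV -!mulrA -legs234M quasi_coassocV.
move: (coprod2 _ * _) => Z; move: PhiV => x; pure2 Z a bcd; pure2 bcd b cd; pure2 cd c d.
pure3 x x1 x2 x3; rewrite legs123_pure !tensor_mulE; tpure.
by rewrite -mulrA !tensor_mulE mul1r.
Qed.

Lemma act_one u : act (1 ⊗ linfun eps ⊗ 1) u = u.
Proof.
apply/lfunP=> g; rewrite act_pure /act0.
transitivity (\tsum_(x1, x3 <- \tsum_(x1, x2, x3 <- PhiV) ((eps x2 : k) *: (x1 ⊗ x3)))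
   (u (x3 * (\tsum_(g1, g2 <- Delta g) ((eps g1 : k) *: g2))) * x1)); last first.
  by rewrite PhiV_counit2 Delta_counitl; tpure; rewrite mulr1 mul1r.
move: (Delta g) PhiV => G x; pure2 G g1 g2; pure3 x x1 x2 x3.
tpure; rewrite linearZ /=; tpure.
rewrite -!(scalerAl, scalerAr) linearZ /= mulr1 -[in RHS](Delta_counitr (u _)).
move: (Delta _) => V; pure2 V v1 v2; tpure.
rewrite lfunE /= !epsM mul1r -!(scalerAl, scalerAr) !scalerA.
by congr (_ *: _); rewrite -[LHS]mulrA [LHS]mulrC -[LHS]mulrA.
Qed.

(** A strict right action, since [Delta] is multiplicative, although H is only
    quasi-coassociative. *)
Definition ract (u : 'End(H)) (a : H) : 'End(H) :=
  linfun (fun g => \tsum_(a1, a2 <- Delta a) (u (a2 * g) * a1)).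

Lemma ractE u a g : ract u a g = \tsum_(a1, a2 <- Delta a) (u (a2 * g) * a1).
Proof. by rewrite lin_lfunE //; lin. Qed.

(** Acting before or after [ract] places the coproducts of a on opposite sides of Φ^-1, and
    [quasi_coassocV] exchanges them. *)
Lemma act_ract (c : C) u a : act c (ract u a) = ract (act c u) a.
Proof.
apply/lfunP=> g; rewrite ractE.
transitivity (\tsum_(a1, a2 <- Delta a)
   ((\tsum_(h, f, l <- c) act0 PhiV h f l u (a2 * g)) * a1)); last first.
  by apply: eq_tlift => a1 a2; rewrite actE.
rewrite actE; rewrite /act0.
pure2 c h fl; pure2 fl f l; tpure.
pose P Z := \tsum_(g1, g2 <- Delta g) \tsum_(p, q, r <- Z)
  \tsum_(v1, v2 <- Delta (u (r * g2 * l))) ((f (v2 * q * g1) : k) *: (h * v1 * p)).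
transitivity (P (coprodl (Delta a) * PhiV)).
  transitivity (\tsum_(g1, g2 <- Delta g) \tsum_(x1, x2, x3 <- PhiV)
    \tsum_(w1, w2 <- Delta (\tsum_(a1, a2 <- Delta a) (u (a2 * (x3 * g2 * l)) * a1)))
      ((f (w2 * x2 * g1) : k) *: (h * w1 * x1))).
    apply: eq_tlift => g1 g2; apply: eq_tlift => x1 x23.
    by apply: eq_tlift => x2 x3; rewrite ractE.
  rewrite /P; move: (Delta a) (Delta g) PhiV => s G x.
  pure2 s a1 a2; pure2 G g1 g2; pure3 x x1 x2 x3; tpure.
  rewrite DeltaM coprodl_pure; move: (Delta a1) => S; pure2 S a11 a12.
  rewrite tassoc_pure !tensor_mulE; tpure; rewrite !mulrA.
  by move: (Delta _) => V; pure2 V v1 v2; rewrite tensor_mulE; tpure; rewrite !mulrA.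
rewrite -quasi_coassocV /P.
transitivity (\tsum_(a1, a2 <- Delta a) ((\tsum_(g1, g2 <- Delta a2 * Delta g)
   \tsum_(x1, x2, x3 <- PhiV) \tsum_(u1, u2 <- Delta (u (x3 * g2 * l)))
   ((f (u2 * x2 * g1) : k) *: (h * u1 * x1))) * a1)); last first.
  by apply: eq_tlift => a1 a2; rewrite -DeltaM; tpure.
move: (Delta a) (Delta g) PhiV => s G x.
pure2 s a1 a2; pure2 G g1 g2; pure3 x x1 x2 x3; tpure.
rewrite coprodr_pure; move: (Delta a2) => S; pure2 S a21 a22.
rewrite !tensor_mulE; tpure; rewrite !mulrA.
by move: (Delta _) => V; pure2 V v1 v2; tpure; rewrite -scalerAl !mulrA.
Qed.

(** * The isomorphism between H^* ⊗ H and Hom(H, H) *)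

(** In terms of q this is φ ⊗ a ↦ (g ↦ φ(q^2 a_2 g) q^1 a_1) with φ = [vec_dual x]. The first factor
    is H in place of its dual so that the target becomes [endo H] ⊗ H. *)
Definition Theta (w : H2) : 'End(H) :=
  linfun (fun g => \tsum_(x, a <- w) \tsum_(X1, X2, X3 <- Phi) \tsum_(a1, a2 <- Delta a)
    ((vec_dual x (T X3 * A * X2 * a2 * g) : k) *: (X1 * a1))).

Lemma ThetaE w g :
  Theta w g = \tsum_(x, a <- w) \tsum_(X1, X2, X3 <- Phi) \tsum_(a1, a2 <- Delta a)
    ((vec_dual x (T X3 * A * X2 * a2 * g) : k) *: (X1 * a1)).
Proof. by rewrite lin_lfunE //; lin. Qed.

Lemma Theta_is_linear : lin Theta.
Proof.
by move=> c w w'; apply/lfunP=> g; rewrite add_lfunE scale_lfunE !ThetaE linearP.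
Qed.
HB.instance Definition _ :=
  GRing.isLinear.Build k H2 'End(H) _ Theta Theta_is_linear.

Lemma Theta_ract x a b : Theta (x ⊗ (a * b)) = ract (Theta (x ⊗ a)) b.
Proof.
apply/lfunP=> g; rewrite ractE ThetaE; tpure; rewrite DeltaM.
transitivity (\tsum_(b1, b2 <- Delta b)
   ((\tsum_(X1, X2, X3 <- Phi) \tsum_(a1, a2 <- Delta a)
    ((vec_dual x (T X3 * A * X2 * a2 * (b2 * g)) : k) *: (X1 * a1))) * b1)); last first.
  by apply: eq_tlift => b1 b2; rewrite ThetaE; tpure.
move: (Delta a) (Delta b) Phi => s t X.
pure2 s a1 a2; pure2 t b1 b2; pure3 X X1 X2 X3; rewrite tensor_mulE; tpure.
by rewrite -scalerAl !mulrA.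
Qed.

(** The preimage is f(S^-1(h_2 p^2) ·) ⊗ h_1 p^1; applying [Theta] reproduces the left side of
    [qp_cancel], which reduces to h ⊗ 1. *)
Lemma Theta_rank_one h (f : dual) :
  Theta (\tsum_(h1, h2 <- Delta h) \tsum_(x1, x2, x3 <- PhiV)
    (dual_vec (hit f 1 (x3 * B * T x2 * T h2)) ⊗ (h1 * x1)))
  = linfun (fun g => (f g : k) *: h).
Proof.
apply/lfunP=> g; rewrite ThetaE lin_lfunE; last by lin.
pose L (t : H2) := \tsum_(a, b <- t) ((f (b * g) : k) *: a).
transitivity (L (h ⊗ 1)); last by rewrite /L; tpure; rewrite mul1r.
rewrite -qp_cancel /L; move: (Delta h) PhiV Phi => s x X.
pure2 s h1 h2; pure3 x x1 x2 x3; pure3 X X1 X2 X3; tpure.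
move: (Delta _) => D; pure2 D d1 d2; tpure.
by rewrite dual_vecK hitE mulr1 !mulrA.
Qed.

Lemma rank_one_sum (u : 'End(H)) :
  u = \sum_i linfun (fun g => coord (vbasis {:H}) i (u g) *: (vbasis {:H})`_i).
Proof.
apply/lfunP=> g; rewrite sum_lfunE [LHS](coord_vbasis (memvf _)).
by apply: eq_bigr => i _; rewrite lin_lfunE //; lin.
Qed.

Lemma Theta_surj u : exists w, Theta w = u.
Proof.
pose f i : dual := (linfun (coord (vbasis {:H}) i : H -> k^o) \o u)%VF.
pose w i := \tsum_(h1, h2 <- Delta (vbasis {:H})`_i) \tsum_(x1, x2, x3 <- PhiV)
    (dual_vec (hit (f i) 1 (x3 * B * T x2 * T h2)) ⊗ (h1 * x1)).
exists (\sum_i w i); rewrite linear_sum [RHS]rank_one_sum; apply: eq_bigr => i _.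
rewrite /= /w Theta_rank_one; apply/lfunP=> g.
rewrite [LHS]lin_lfunE; last by lin.
rewrite [RHS]lin_lfunE; last by lin.
by rewrite /f comp_lfunE lfunE.
Qed.

(** * Faithfulness of the action *)

(** The value at g of the action on the rank-one operator y ↦ f'(y) h', with the functional f' not
    yet applied to the second factor. *)
Definition act_rank_one (x : H3) (c : C) h' g : H2 :=
  tlift (fun h => tlift (fun (f : dual) l =>
    \tsum_(g1, g2 <- Delta g) \tsum_(x1, x2, x3 <- x) \tsum_(v1, v2 <- Delta h')
      ((f (v2 * x2 * g1) : k) *: ((h * v1 * x1) ⊗ (x3 * g2 * l))))) c.

Lemma act_rank_oneE (c : C) h' (f' : dual) g :
  act c (linfun (fun y => (f' y : k) *: h')) g =
  \tsum_(p, q <- act_rank_one PhiV c h' g) ((f' q : k) *: p).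
Proof.
rewrite actE /act0 /act_rank_one.
pure2 c h fl; pure2 fl f l; tpure.
move: (Delta g) PhiV => G x; pure2 G g1 g2; pure3 x x1 x2 x3; tpure.
rewrite lin_lfunE; last by lin.
rewrite linearZ /=; move: (Delta h') => D; pure2 D d1 d2.
tpure; rewrite [LHS]linearZ [RHS]linearZ /=; tpure.
by rewrite !scalerA; congr (_ *: _); apply: mulrC.
Qed.

(** This is φ(q^1 g_1) h ⊗ q^2 g_2 l, the shape to which [qp_cancel] applies. *)
Definition act_q (c : C) g : H2 :=
  tlift (fun h => tlift (fun (f : dual) l =>
    \tsum_(X1, X2, X3 <- Phi) \tsum_(g1, g2 <- Delta g)
      ((f (X1 * g1) : k) *: (h ⊗ (T X3 * A * X2 * g2 * l))))) c.

(* The pentagon trades the Φ^-1 occurring in the action for q.                *)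
Lemma act_qE (c : C) g :
  \tsum_(X1, X2, X3 <- Phi) \tsum_(y1, y2, y3 <- PhiV)
  \tsum_(p, q <- act_rank_one PhiV c X1 (y2 * g)) ((p * y1) ⊗ (T (X3 * y3) * A * X2 * q))
  = act_q c g.
Proof.
rewrite /act_q; move: c.
apply: tensor_ext; [rewrite /act_rank_one; lin | lin | move=> h].
apply: tensor_ext; [rewrite /act_rank_one; lin | lin | move=> f l].
pose P (Z : H4) : H2 := tlift (fun a => tlift (fun b => tlift (fun c d =>
   (f b : k) *: ((h * a) ⊗ (T d * A * c * l))))) Z.
transitivity (P (coprod1 Phi * legs123 PhiV * coprod2 PhiV *
                 legs234 (tassoc (Delta g ⊗ 1)))).
  have PE X x y : \tsum_(X1, X2, X3 <- X) \tsum_(y1, y2, y3 <- y)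
      \tsum_(p, q <- act_rank_one x (h ⊗ f ⊗ l) X1 (y2 * g))
        ((p * y1) ⊗ (T (X3 * y3) * A * X2 * q))
      = P (coprod1 X * legs123 x * coprod2 y * legs234 (tassoc (Delta g ⊗ 1))).
    rewrite /P /act_rank_one.
    pure3 X X1 X2 X3; pure3 x x1 x2 x3; pure3 y y1 y2 y3; tpure.
    rewrite DeltaM coprod1_pure legs123_pure coprod2_pure coprodl_pure legs234_pure.
    move: (Delta X1) (Delta y2) (Delta g) => D E G.
    pure2 D d1 d2; pure2 E e1 e2; pure2 G g1 g2.
    rewrite !(tassoc_pure, tensor_mulE); tpure; rewrite linearZ /=; tpure.
    by rewrite !mulr1 !mulrA.
  exact: PE.
(* Now Δ(y^3) sits in legs 3, 4, where [P] contracts it to ε(y^3) A; then [PhiV_counit3] removes the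
   whole Φ^-1. *)
have [_ _ ->] := pentagonV.
tpure.
transitivity (\tsum_(y1, y2 <- \tsum_(y1, y2, y3 <- PhiV) ((eps y3 : k) *: (y1 ⊗ y2)))
  \tsum_(X1, X2, X3 <- Phi) \tsum_(g1, g2 <- Delta g)
   ((f (y2 * X1 * g1) : k) *: ((h * y1) ⊗ (T X3 * A * X2 * g2 * l)))); last first.
  rewrite PhiV_counit3; move: Phi (Delta g) => X G.
  by pure3 X X1 X2 X3; pure2 G g1 g2; tpure; rewrite mul1r mulr1.
rewrite /P; move: Phi => X; move: PhiV (Delta g) => y G.
pure3 X X1 X2 X3; pure3 y y1 y2 y3; pure2 G g1 g2; tpure.
rewrite linearZ /=; tpure.
transitivity ((f (y2 * X1 * g1) : k) *: ((h * y1) ⊗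
   (T X3 * (\tsum_(a, b <- Delta y3) (T b * A * a)) * X2 * g2 * l))).
  rewrite coprod3_pure coprodr_pure !legs234_pure tassoc_pure.
  move: (Delta y3) => D; pure2 D d1 d2.
  by rewrite !tensor_mulE; tpure; rewrite !mulr1 TM !mulrA.
rewrite T_alphaP -!(scalerAl, scalerAr) linearZr_LR /= !scalerA.
by congr (_ *: _); apply: mulrC.
Qed.

(** Evaluating [act_q] at a_1 p^1 and multiplying by S^-1(a_2 p^2) forms the left side of
    [qp_cancel], which becomes a ⊗ 1. *)
Lemma act_q_recover (c : C) a :
  \tsum_(a1, a2 <- Delta a) \tsum_(x1, x2, x3 <- PhiV)
  \tsum_(p, q <- act_q c (a1 * x1)) (p ⊗ (x3 * B * T x2 * T a2 * q))
  = tlift (fun h => tlift (fun (f : dual) l => (f a : k) *: (h ⊗ l))) c.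
Proof.
move: c; apply: tensor_ext; [rewrite /act_q; lin | lin | move=> h].
apply: tensor_ext; [rewrite /act_q; lin | lin | move=> f l].
pose L (t : H2) : H2 := \tsum_(b, d <- t) ((f b : k) *: (h ⊗ (d * l))).
transitivity (L (a ⊗ 1)); last by rewrite /L; tpure; rewrite mul1r.
rewrite -qp_cancel /L /act_q; move: (Delta a) PhiV Phi => s x X.
pure2 s h1 h2; pure3 x x1 x2 x3; pure3 X X1 X2 X3; tpure.
move: (Delta _) => D; pure2 D d1 d2; tpure.
by rewrite linearZ /=; tpure; rewrite !mulrA.
Qed.

(** If c acts as zero, so do its values on rank-one operators, hence [act_q] and all Σ φ(a) h ⊗ l
    vanish; coordinates in h and l then kill c. *)
Lemma act_inj (c : C) : (forall u, act c u = 0) -> c = 0.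
Proof.
move=> c0.
have R0 h' g : act_rank_one PhiV c h' g = 0.
  apply: tensor_sepr => i.
  have := act_rank_oneE c h' (linfun (coord (vbasis {:H}) i : H -> k^o)) g.
  rewrite c0 zero_lfunE => /esym; rewrite -[RHS]/(0 : H) => <-.
  by apply: eq_tlift => p q; rewrite lfunE.
have Q0 g : act_q c g = 0.
  rewrite -act_qE; apply: tlift_eq0 => X1 ?; apply: tlift_eq0 => X2 X3.
  apply: tlift_eq0 => y1 ?; apply: tlift_eq0 => y2 y3.
  by rewrite R0 linear0.
have C0 a : tlift (fun h => tlift (fun (f : dual) l => (f a : k) *: (h ⊗ l))) c = 0.
  rewrite -act_q_recover; apply: tlift_eq0 => a1 a2.
  apply: tlift_eq0 => x1 ?; apply: tlift_eq0 => x2 x3.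
  by rewrite Q0 linear0.
apply: tensor_sepl => i; apply: tensor_sepr => j; apply/lfunP=> a.
rewrite zero_lfunE.
pose L (t : H2) : k^o :=
  \tsum_(h, l <- t) (coord (vbasis {:H}) i h * coord (vbasis {:H}) j l : k^o).
have := congr1 L (C0 a); rewrite /L [RHS]linear0 => <-.
move: c {c0 R0 Q0 C0}; apply: tensor_ext; [by lin | by lin | move=> h].
apply: tensor_ext; [by lin | by lin | move=> f l].
tpure; rewrite linearZ /= [RHS]linearZ /=; tpure.
transitivity
  ((coord (vbasis {:H}) i h *: (coord (vbasis {:H}) j l *: f : dual) : dual) a) => //.
rewrite !scale_lfunE scalerA.
exact: mulrC.
Qed.

(** * The isomorphism of algebras *)

Lemma lin_act_l u : lin (fun c : C => act c u).
Proof.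
by move=> d c c'; apply/lfunP=> g; rewrite add_lfunE scale_lfunE !actE linearP.
Qed.

Lemma lin_act_r (c : C) : lin (act c).
Proof.
move=> d u u'; apply/lfunP=> g; rewrite add_lfunE scale_lfunE !actE.
have act0_lin : lin (fun u => \tsum_(h, f, l <- c) act0 PhiV h f l u g).
  by rewrite /act0; lin.
exact: act0_lin.
Qed.

(** A surjection between spaces of dimension (dim H)^2. *)
Lemma ThetaL_inj : injective (linfun Theta).
Proof.
apply: surj_dim_inj; last by rewrite dim_tensor dim_hom.
by move=> u; have [w <-] := Theta_surj u; exists w; rewrite lfunE.
Qed.

Lemma Theta_inj : injective Theta.
Proof. by move=> w w' e; apply: ThetaL_inj; rewrite !lfunE. Qed.

Definition ThetaV : 'Hom('End(H), H2) := ((linfun Theta)^-1)%VF.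

Lemma ThetaK : cancel Theta ThetaV.
Proof.
move=> w; rewrite -[in LHS](lfunE Theta) lker0_lfunK //.
exact/lker0P/ThetaL_inj.
Qed.

Lemma ThetaVK : cancel ThetaV Theta.
Proof. by move=> u; have [w <-] := Theta_surj u; rewrite ThetaK. Qed.

(** The action transported along [Theta], so that [ract] becomes right multiplication on the second
    factor. *)
Definition crossed_rep (c : C) : 'End(H2) :=
  linfun (fun w => ThetaV (act c (Theta w))).

Lemma crossed_repE c w : crossed_rep c w = ThetaV (act c (Theta w)).
Proof.
rewrite lin_lfunE // => d w1 w2.
by rewrite linearP lin_act_r linearP.
Qed.

Lemma crossed_rep_is_linear : lin crossed_rep.
Proof.
move=> d c c'; apply/lfunP=> w; rewrite add_lfunE scale_lfunE !crossed_repE.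
by rewrite lin_act_l linearP.
Qed.
HB.instance Definition _ :=
  GRing.isLinear.Build k C 'End(H2) _ crossed_rep crossed_rep_is_linear.

Lemma Theta_rmul w b : Theta (rmul w b) = ract (Theta w) b.
Proof.
apply/lfunP=> g; rewrite ractE; pure2 w x a.
by rewrite /rmul; tpure; rewrite Theta_ract ractE.
Qed.

Lemma crossed_rep_rmul (c : C) x a b :
  crossed_rep c (x ⊗ (a * b)) = rmul (crossed_rep c (x ⊗ a)) b.
Proof.
apply: Theta_inj; rewrite Theta_rmul !crossed_repE !ThetaVK Theta_ract.
exact: act_ract.
Qed.

Lemma crossed_rep_inj : injective crossed_rep.
Proof.
suff inj0 (c : C) : crossed_rep c = 0 -> c = 0.
  by move=> s t /eqP; rewrite -subr_eq0 -linearB => /eqP/inj0/subr0_eq.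
move=> c0; apply: act_inj => u; rewrite -[u]ThetaVK -[act c _]ThetaVK.
by rewrite -crossed_repE c0 zero_lfunE linear0.
Qed.

Lemma crossed_rep_one : crossed_rep (1 ⊗ linfun eps ⊗ 1) = \1%VF.
Proof. by apply/lfunP=> w; rewrite crossed_repE act_one ThetaK id_lfunE. Qed.

Lemma crossed_rep_cross h f l h' f' l' :
  crossed_rep (cross PhiV PhiV h f l h' f' l') =
  (crossed_rep (h ⊗ f ⊗ l) \o crossed_rep (h' ⊗ f' ⊗ l'))%VF.
Proof.
by apply/lfunP=> w; rewrite comp_lfunE !crossed_repE act_cross ThetaVK.
Qed.

Lemma crossed_product_iso :
  exists F : {linear C -> (endo H ⊗ H)%type},
    [/\ bijective F, F (1 ⊗ linfun eps ⊗ 1) = 1 &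
        forall h f l h' f' l',
          F (cross PhiV PhiV h f l h' f' l') = F (h ⊗ f ⊗ l) * F (h' ⊗ f' ⊗ l')].
Proof.
pose G := linfun (@endo_act k H).
(* [G^-1] inverts [endo_act] only on its image; [FE] holds because [crossed_rep c] lies there by
   [endo_act_commutant]. *)
pose F := (G^-1 \o linfun crossed_rep)%VF.
have FE c : endo_act (F c) = crossed_rep c.
  have [t tc] := endo_act_commutant (crossed_rep_rmul c).
  rewrite -[LHS](lfunE (@endo_act k H)) comp_lfunE limg_lfunVK ?lfunE //.
  by rewrite /= -tc -(lfunE (@endo_act k H)) memv_img ?memvf.
exists F; split.
- apply: inj_dim_bij.
    by move=> c c' e; apply: crossed_rep_inj; rewrite -!FE e.
  have dim1 : \dim {:k^o} = 1%N by rewrite dimvf.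
  have dimE : \dim {:endo H} = (\dim {:H} * \dim {:H})%N by exact: dim_hom.
  by rewrite !dim_tensor (dim_hom H k^o) dim1 dimE muln1 mulnA.
- by apply: endo_act_inj; rewrite FE crossed_rep_one endo_act1.
- move=> h f l h' f' l'; apply: endo_act_inj.
  by rewrite endo_actM !FE crossed_rep_cross.
Qed.

End QuasiHopfData.

(** * The inverse antipode and the transported axioms *)

Section AntipodeInverse.
Variables (k : fieldType) (H : quasiHopfType k).
Implicit Types g h : H.
Local Notation Delta := (@coproduct k H).
Local Notation eps := (@counit k H).
Local Notation Phi := (@associator k H).
Local Notation PhiV := (@associator k H)^-1.

Definition antipodeV : 'End(H) := ((linfun (@antipode k H))^-1)%VF.
Definition alphaV : H := antipodeV (@antipode_alpha k H).
Definition betaV : H := antipodeV (@antipode_beta k H).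
Local Notation T := antipodeV.
Local Notation A := alphaV.
Local Notation B := betaV.

Lemma antipode_ker : lker (linfun (@antipode k H)) == 0%VS.
Proof.
apply/lker0P=> x y; rewrite !lfunE; exact: (bij_inj (@antipode_bij k H)).
Qed.

Lemma antipodeK : cancel (@antipode k H) T.
Proof. by move=> h; rewrite -[in RHS](lker0_lfunK antipode_ker h) lfunE. Qed.

Lemma antipodeVK : cancel T (@antipode k H).
Proof. by move=> h; rewrite -[in RHS](lker0_lfunVK antipode_ker h) lfunE. Qed.

Lemma antipodeVM g h : T (g * h) = T h * T g.
Proof.
by rewrite -{1}[g]antipodeVK -{1}[h]antipodeVK -antipodeM antipodeK.
Qed.

Lemma antipodeV1 : T 1 = 1.
Proof. by rewrite -[in LHS](antipode1 (s := H)) antipodeK. Qed.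

(** Applying S^-1 to the axiom for α reverses the order of the factors. *)
Lemma antipodeV_alphaP h :
  \tsum_(h1, h2 <- Delta h) (T h2 * A * h1) = (eps h : k) *: A.
Proof.
rewrite /alphaV -linearZ /= -antipode_alphaP -(tlift_lin (f := T)); last by lin.
by apply: eq_tlift => a b; rewrite !antipodeVM antipodeK mulrA.
Qed.

Lemma antipodeV_betaP h :
  \tsum_(h1, h2 <- Delta h) (h2 * B * T h1) = (eps h : k) *: B.
Proof.
rewrite /betaV -linearZ /= -antipode_betaP -(tlift_lin (f := T)); last by lin.
by apply: eq_tlift => a b; rewrite !antipodeVM antipodeK mulrA.
Qed.

Lemma antipodeV_associatorV :
  \tsum_(x1, x2, x3 <- PhiV) (x3 * B * T x2 * A * x1) = 1.
Proof.
rewrite -antipodeV1 -antipode_associatorV -(tlift_lin (f := T)); last by lin.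
apply: eq_tlift => a bc; rewrite -(tlift_lin (f := T)); last by lin.
by apply: eq_tlift => b c; rewrite !antipodeVM !antipodeK !mulrA.
Qed.

End AntipodeInverse.

Theorem theorem5p9 (k : fieldType) (H : quasiHopfType k) :
  exists F : {linear two_sided_crossed H -> (endo H ⊗ H)%type},
    [/\ bijective F,
        F (crossed_one H) = 1 &
        forall s t, F (crossed_mul s t) = F s * F t].
Proof.
have [F [Fbij F1 FM]] := @crossed_product_iso k H (@coproduct k H) (@counit k H)
  (@associator k H) (@associator k H)^-1 (rmorphM _) (rmorph1 _) (rmorphM _)
  (rmorph1 _) (mulVr associator_unit) (mulrV associator_unit)
  coproduct_quasi_coassoc coproduct_counitr coproduct_counitl associator_pentagon
  associator_counit2 associator_counit3 (@antipodeV k H) (alphaV H) (betaV H)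
  (@antipodeVM k H) (@antipodeV_alphaP k H) (@antipodeV_betaP k H)
  (@antipodeV_associatorV k H).
exists F; split => // s t.
have lin_mul (L : lmodType k) s' (g : L -> two_sided_crossed H) :
    lin g -> lin (fun x => F (crossed_mul s' (g x))).
  by move=> lg c x y; rewrite lg linearPr linearP.
pure2 s h fl; pure2 fl f l.
move: t; apply: tensor_ext => [||h' t]; [by apply: lin_mul | by lin |].
move: t; apply: tensor_ext => [||f' l']; [by apply: lin_mul; lin | by lin |].
(* [cross] at Φ^-1 unfolds to [crossed_mul_pure], so the two products agree by conversion. *)
by rewrite crossed_mulE; apply: FM.
Qed.
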